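(* Let $n\ge2$, $k\ge1$. The assignment $P_k^+\ni\hat\lambda\mapsto s_{\lambda^t}$, with $\lambda=\mathrm P(\hat\lambda)$, defines an isomorphism of rings $$\mathcal F(\widehat{\mathfrak{sl}}(n))_k\;\cong\;\mathbb Z[e_1,\dots,e_k]\big/\big\langle h_n-1,\;h_{n+1},\dots,h_{n+k-1},\;h_{n+k}+(-1)^ke_k\big\rangle .$$ Hence the fusion ring is isomorphic to the quotient of the quantum cohomology ring $qH^\bullet(\mathrm{Gr}_{k,n+k})$ obtained by imposing the additional relations $q=e_k$ and $h_n=1$.
   Context: $\mathbb Z[e_1,\dots,e_k]$ is the ring of symmetric polynomials in $k$ variables, $e_i$ and $h_r$ being the elementary and complete symmetric polynomials and $s_\mu$ the Schur polynomial in these $k$ variables. $qH^\bullet(\mathrm{Gr}_{k,n+k})$ is the small quantum cohomology ring, in the presentation (Siebert–Tian) $qH^\bullet(\mathrm{Gr}_{k,n+k})\cong\mathbb Z[q]\otimes_{\mathbb Z}\mathbb Z[e_1,\dots,e_k]/\langle h_{n+1},\dots,h_{n+k-1},h_{n+k}+(-1)^kq\rangle$. $P_k^+$ is the set of $\hat\lambda=(m_0,\dots,m_{n-1})\in\mathbb Z_{\ge0}^n$ with $\sum m_i=k$ (level $k$ dominant weights of $\widehat{\mathfrak{sl}}(n)$). $\mathrm P(\hat\lambda)=\lambda$ is the partition with $\lambda_i-\lambda_{i+1}=m_i$, $1\le i\le n-1$, $\lambda_n=0$; $\lambda^t$ is the transposed partition. The fusion ring $\mathcal F(\widehat{\mathfrak{sl}}(n))_k$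 is the free $\mathbb Z$-module on $P_k^+$ with product $\hat\lambda*\hat\mu=\sum_{\hat\nu}\mathcal N_{\hat\lambda\hat\mu}^{(k),\hat\nu}\hat\nu$, where the structure constants (nonnegative integers) are given by the Verlinde formula $$\mathcal N_{\hat\lambda\hat\mu}^{(k),\hat\nu}=\sum_{\hat\sigma\in P_k^+}\frac{\mathcal S_{\hat\lambda\hat\sigma}\mathcal S_{\hat\mu\hat\sigma}\mathcal S_{\hat\nu^*\hat\sigma}}{\mathcal S_{0\hat\sigma}}.$$ Here $\hat\nu^*$ is $\hat\nu$ with $m_i$ replaced by $m_{n-i}$ ($1\le i\le n-1$), the index $0$ stands for $(k,0,\dots,0)$, and $$\mathcal S_{\hat\lambda\hat\sigma}=\frac{e^{\iota\pi n(n-1)/4}}{\sqrt{n(k+n)^{n-1}}}\sum_{w\in S_n}(-1)^{\ell(w)}e^{-\frac{2\pi\iota}{k+n}(\sigma+\rho,\,w(\lambda+\rho))},\quad\iota=\sqrt{-1},$$ with $\lambda$ here denoting $\sum_{i=1}^n(\lambda_i-|\lambda|/n)\varepsilon_i$ for the partition $\mathrm P(\hat\lambda)$, likewise $\sigma$, $\rho=\sum_{i=1}^n(\frac{n+1}2-i)\varepsilon_i$, $(\varepsilon_i,\varepsilon_j)=\delta_{ij}$. (By a theorem of the paper this product is also given by noncommutative Schur polynomials acting on the span of $P_k^+$, the ''combinatorial fusion ring''.) *)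

(* Defs.v *)
From HB Require Import structures.
From mathcomp Require Import all_boot all_order all_algebra perm.
From mathcomp Require Import generic_quotient ring_quotient complex mpoly.
From mathcomp Require Import boolp reals zify.
(* [trigo] is only used qualified: importing MathComp-Analysis clashes with the
   notations of [mpoly]. *)
From mathcomp Require trigo.

Set Implicit Arguments.
Unset Strict Implicit.
Unset Printing Implicit Defensive.

Import Order.TTheory GRing.Theory Num.Theory.
Local Open Scope ring_scope.
Local Open Scope quotient_scope.
Local Open Scope complex_scope.

(* [ring_quotient] only has quotients by proper ideals; here the ideal may be the
   whole ring, so the quotient is a possibly zero ring. *)
Section QuotientRing.
Variables (R : comPzRingType) (gens : seq R).

Definition ideal_gen (x : R) : bool :=
  `[< exists c : 'I_(size gens) -> R, x = \sum_i c i * gens`_i >].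

Lemma ideal_gen_zmod_closed : zmod_closed ideal_gen.
Proof.
split=> [|x y /asboolP[c ->] /asboolP[d ->]]; apply/asboolP.
  by exists (fun=> 0); rewrite big1 // => i _; rewrite mul0r.
exists (fun i => c i - d i); rewrite -sumrB.
by apply: eq_bigr => i _; rewrite mulrBl.
Qed.

HB.instance Definition _ := GRing.isZmodClosed.Build R ideal_gen
  ideal_gen_zmod_closed.

Lemma ideal_genM a x : x \in ideal_gen -> a * x \in ideal_gen.
Proof.
move=> /asboolP[c ->]; apply/asboolP; exists (fun i => a * c i).
by rewrite mulr_sumr; apply: eq_bigr => i _; rewrite mulrA.
Qed.

Definition quotring := Quotient.quot (GRing.ZmodClosed.clone R ideal_gen _).

HB.instance Definition _ := GRing.Zmodule.on quotring.

Definition quotring_proj (x : R) : quotring := \pi_(quotring) x.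

Lemma quotring_projP x y :
  reflect (quotring_proj x = quotring_proj y) (x - y \in ideal_gen).
Proof. by rewrite Quotient.idealrBE; apply: eqP. Qed.

Lemma quotring_proj_surj (z : quotring) : exists x, quotring_proj x = z.
Proof. by exists (repr z); rewrite /quotring_proj reprK. Qed.

Definition quotring_one : quotring := quotring_proj 1.
Definition quotring_mul (a b : quotring) : quotring :=
  quotring_proj (repr a * repr b).

Lemma quotring_mulE x y :
  quotring_mul (quotring_proj x) (quotring_proj y) = quotring_proj (x * y).
Proof.
have E z : repr (quotring_proj z) - z \in ideal_gen.
  by apply/quotring_projP; rewrite /quotring_proj reprK.
rewrite /quotring_mul; apply/quotring_projP.
move: (E x) (E y); set a := repr _; set b := repr _ => Ea Eb.
have -> : a * b - x * y = a * (b - y) + y * (a - x).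
  by rewrite !mulrBr addrA [y * a]mulrC addrNK [y * x]mulrC.
by rewrite rpredD // ideal_genM.
Qed.

Fact quotring_mulA : associative quotring_mul.
Proof.
move=> a b c; case: (quotring_proj_surj a) => x <-.
case: (quotring_proj_surj b) => y <-; case: (quotring_proj_surj c) => z <-.
by rewrite !quotring_mulE mulrA.
Qed.

Fact quotring_mulC : commutative quotring_mul.
Proof. by move=> a b; rewrite /quotring_mul mulrC. Qed.

Fact quotring_mul1 : left_id quotring_one quotring_mul.
Proof.
by move=> a; case: (quotring_proj_surj a) => x <-; rewrite quotring_mulE mul1r.
Qed.

Lemma quotring_projD : {morph quotring_proj : x y / x + y}.
Proof. by move=> x y; rewrite /quotring_proj raddfD. Qed.

Fact quotring_mulDl : left_distributive quotring_mul +%R.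
Proof.
move=> a b c; case: (quotring_proj_surj a) => x <-.
case: (quotring_proj_surj b) => y <-; case: (quotring_proj_surj c) => z <-.
by rewrite -quotring_projD !quotring_mulE mulrDl quotring_projD.
Qed.

HB.instance Definition _ := GRing.Zmodule_isComPzRing.Build quotring
  quotring_mulA quotring_mulC quotring_mul1 quotring_mulDl.

Fact quotring_proj_zmod_morphism : zmod_morphism quotring_proj.
Proof. by move=> x y; rewrite /quotring_proj raddfB. Qed.

HB.instance Definition _ := GRing.isZmodMorphism.Build R quotring quotring_proj
  quotring_proj_zmod_morphism.

Fact quotring_proj_monoid_morphism : monoid_morphism quotring_proj.
Proof. by split=> // x y; rewrite -quotring_mulE. Qed.

HB.instance Definition _ := GRing.isMonoidMorphism.Build R quotring quotring_proj
  quotring_proj_monoid_morphism.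

End QuotientRing.

Section SymPoly.
Variable k : nat.

Record sympoly := SymPoly {
  sympoly_val :> {mpoly int[k]};
  _ : sympoly_val \is symmetric }.

HB.instance Definition _ := [isSub for sympoly_val].
HB.instance Definition _ := [Choice of sympoly by <:].
HB.instance Definition _ := [SubChoice_isSubComNzRing of sympoly by <:].

Definition sym_e (r : nat) : sympoly := SymPoly (mesym_sym k int r).

Definition mcsym (r : nat) : {mpoly int[k]} :=
  \sum_(m : 'X_{1..k < r.+1} | mdeg m == r) 'X_[m].

Lemma mcoeff_mcsym r m : (mcsym r)@_m = (mdeg m == r)%:R.
Proof.
rewrite raddf_sum /=; case: (altP (mdeg m =P r)) => [degm|neq].
  have ltm : (mdeg m < r.+1)%N by rewrite degm.
  rewrite (bigD1 (BMultinom ltm)) //= ?degm //.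
  rewrite mcoeffX eqxx big1 ?addr0 // => m' /andP[_ /negPf ne].
  rewrite mcoeffX; case: eqP => // eqm; case/eqP: ne.
  exact: val_inj.
rewrite big1 // => m' /eqP degm'; rewrite mcoeffX.
by case: eqP => // eqm; case/eqP: neq; rewrite -eqm.
Qed.

Lemma mcsym_sym r : mcsym r \is symmetric.
Proof.
apply/issymP => s; apply/mpolyP => m.
by rewrite mcoeff_sym !mcoeff_mcsym mdeg_mperm.
Qed.

Definition sym_h (r : nat) : sympoly := SymPoly (mcsym_sym r).

(* Jacobi-Trudi: [det (h_(mu_i - i + j))], with [h_r = 0] for [r < 0]. *)
Definition schur (mu : 'I_k -> nat) : sympoly :=
  \det (\matrix_(i < k, j < k)
          if (i <= mu i + j)%N then sym_h (mu i + j - i) else 0).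

End SymPoly.

Section BialternantFormula.
Variable k : nat.
Local Notation A := {mpoly int[k]}.

(* [mcsym] in the variables of index in [s]. *)
Let hs (s : seq 'I_k) (r : nat) : A :=
  \sum_(m : 'X_{1..k < r.+1} |
        (mdeg m == r) && [forall i, (i \notin s) ==> (m i == 0%N)]) 'X_[m].

Let mcoeff_hs s r m :
  (hs s r)@_m = ((mdeg m == r) && [forall i, (i \notin s) ==> (m i == 0%N)])%:R.
Proof.
rewrite raddf_sum /=; case: andP => [[/eqP degm sm]|neq].
  have ltm : (mdeg m < r.+1)%N by rewrite degm.
  rewrite (bigD1 (BMultinom ltm)) /= ?degm ?eqxx //.
  rewrite mcoeffX eqxx big1 ?addr0 // => m' /andP[_ /negPf ne].
  rewrite mcoeffX; case: eqP => // eqm; case/eqP: ne.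
  exact: val_inj.
rewrite big1 // => m' /andP[degm' sm']; rewrite mcoeffX.
by case: eqP => // eqm; case: neq; rewrite -eqm.
Qed.

Let hs0 s : hs s 0 = 1.
Proof.
apply/mpolyP => m; rewrite mcoeff_hs mcoeff1 mdeg_eq0.
case: eqP => //= ->; case: forallP => // -[] i.
by rewrite mnm0E eqxx implybT.
Qed.

Let hs_cons i s r : i \notin s -> hs (i :: s) r.+1 = hs s r.+1 + 'X_i * hs (i :: s) r.
Proof.
move=> nis; apply/mpolyP => m; rewrite mcoeffD mulrC !mcoeff_hs.
case: (altP (m i =P 0%N)) => [mi0|mi_neq0].
  have -> : (hs (i :: s) r * 'X_i)@_m = 0.
    apply: memN_msupp_eq0; apply/negP => /msuppM_le; rewrite msuppX.
    move=> /allpairsP[[p1 p2]] /= [_]; rewrite mem_seq1 => /eqP -> eqm.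
    by move: mi0; rewrite eqm mnmDE mnm1E eqxx addn1.
  rewrite addr0; congr (_ && _)%:R; apply: eq_forallb => j.
  rewrite inE; case: eqP => [->|_] //=.
  by rewrite mi0 eqxx implybT.
have lem : (U_(i) <= m)%MM by rewrite lep1mP.
have -> : (hs (i :: s) r * 'X_i)@_m = (hs (i :: s) r)@_(m - U_(i))%MM.
  by rewrite -{1}(submK lem) addmC mcoeffMX.
rewrite mcoeff_hs.
have -> : [forall j, (j \notin s) ==> (m j == 0%N)] = false.
  by apply/negbTE/forallPn; exists i; rewrite nis (negPf mi_neq0).
rewrite andbF add0r -{1}(submK lem) mdegD mdeg1 addn1 eqSS.
congr (_ && _)%:R; apply: eq_forallb => j; rewrite inE mnmBE mnm1E.
by case: (eqVneq j i) => [//|ne] /=; rewrite subn0.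
Qed.

Let hs_all s r : (forall i, i \in s) -> hs s r = mcsym k r.
Proof.
move=> sT; apply/mpolyP => m; rewrite mcoeff_hs mcoeff_mcsym.
have -> : [forall i, (i \notin s) ==> (m i == 0%N)].
  by apply/forallP => i; rewrite sT.
by rewrite andbT.
Qed.

Let hs1 i r : hs [:: i] r = 'X_i ^+ r.
Proof.
apply/mpolyP => m; rewrite mcoeff_hs mpolyXn mcoeffX.
congr (_ : bool)%:R; apply/andP/eqP => [[/eqP degm /forallP sm]|<-].
  have z j : j != i -> m j = 0%N by move=> ne; apply/eqP; apply: (implyP (sm j)); rewrite inE.
  apply/mnmP => j; rewrite mulmnE mnm1E; case: eqP => [<-|/eqP ne].
    by rewrite mul1n -degm mdegE (bigD1 i) //= big1 ?addn0.
  by rewrite mul0n z // eq_sym.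
rewrite mdegMn mdeg1 mul1n; split=> //; apply/forallP => j; apply/implyP.
by rewrite inE mulmnE mnm1E eq_sym => /negPf ->.
Qed.

Let G (s : seq 'I_k) (j : nat) : A :=
  if (size s <= j.+1)%N then hs s (j.+1 - size s) else 0.

Let L (s : seq 'I_k) (N : nat) (p : {poly A}) : A := \sum_(j < N) p`_j * G s j.

Let G_cons i s j : i \notin s -> G (i :: s) j.+1 - 'X_i * G (i :: s) j = G s j.
Proof.
move=> nis; rewrite /G /= !ltnS !subSS; case: (ltngtP (size s) j.+1) => [|lt|eqs].
- by rewrite ltnS => le; rewrite le subSn // hs_cons // addrK.
- by rewrite leqNgt (ltnW lt) mulr0 subr0.
- by rewrite eqs ltnn subnn !hs0 mulr0 subr0.
Qed.

Let L_cons i s N (p : {poly A}) : i \notin s -> (size p <= N)%N ->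
  L (i :: s) N.+1 (p * ('X - ('X_i)%:P)) = L s N p.
Proof.
move=> nis szp; rewrite /L.
under eq_bigr do rewrite mulrBr coefB mulrBl.
rewrite sumrB big_ord_recl coefMX mul0r add0r big_ord_recr /=.
rewrite coefMC (nth_default 0 szp) !mul0r addr0 -sumrB.
apply: eq_bigr => j _; rewrite coefMX coefMC /bump leq0n add1n /= -(G_cons j nis).
by rewrite mulrBr mulrA.
Qed.

Let L_cat s s0 N (p : {poly A}) : uniq (s ++ s0) -> (size p <= N)%N ->
  L (s ++ s0) (size s + N) (p * \prod_(i <- s) ('X - ('X_i)%:P)) = L s0 N p.
Proof.
move=> + szp; elim: s => [|i s IHs] /=; first by rewrite big_nil mulr1.
case/andP=> nis us; rewrite big_cons mulrCA [X in L _ _ X]mulrC addSn L_cons ?IHs //.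
apply: (leq_trans (size_polyMleq _ _)); rewrite size_prod_XsubC.
by rewrite addnS /= addnC leq_add2l.
Qed.

(* [schur mu] is the quotient of alternants
   [det (x_j ^ (mu_i + k - i)) / det (x_j ^ (k - i))]. *)
Lemma schur_bialternant (mu : 'I_k -> nat) :
  sympoly_val (schur mu) * \det (\matrix_(i < k, j < k) 'X_j ^+ (k - i.+1))
  = \det (\matrix_(i < k, j < k) 'X_j ^+ (mu i + (k - i.+1))).
Proof.
pose JT (nu : 'I_k -> nat) : 'M[A]_k := \matrix_(i, j)
  if (i <= nu i + j)%N then mcsym k (nu i + j - i) else 0.
pose s l := [seq i <- enum 'I_k | i != l].
pose Q l : {poly A} := \prod_(i <- s l) ('X - ('X_i)%:P).
have uT l : uniq (s l ++ [:: l]).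
  rewrite cat_uniq filter_uniq ?enum_uniq //= orbF andbT.
  by rewrite mem_filter eqxx.
have inT l i : i \in s l ++ [:: l].
  by rewrite mem_cat mem_filter mem_enum inE andbT; case: eqP.
have szT l : (size (s l)).+1 = k.
  have : perm_eq (s l ++ [:: l]) (enum 'I_k).
    by apply: uniq_perm; rewrite ?enum_uniq // => i; rewrite inT mem_enum.
  by move=> /perm_size; rewrite size_cat addn1 size_enum_ord.
pose M : 'M[A]_k := \matrix_(j, l) (Q l)`_j.
have JTM nu : JT nu *m M = \matrix_(i, j) 'X_j ^+ (nu i + (k - i.+1)).
  apply/matrixP => i l; rewrite !mxE; set a := (nu i + _)%N.
  have := @L_cat (s l) [:: l] a.+1 'X^a (uT l).
  rewrite size_polyXn => /(_ (leqnn _)) /esym.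
  rewrite {1}/L big_ord_recr big1 /= => [|j _]; last first.
    by rewrite coefXn (ltn_eqF (ltn_ord j)) mul0r.
  rewrite add0r coefXn eqxx mul1r {1}/G /= subn1 /= hs1 => ->.
  rewrite /L addnS -addSn szT (addnC k a) big_split_ord /=.
  rewrite [X in _ = X + _]big1 ?add0r; last first.
    by move=> j _; rewrite coefXnM ltn_ord mul0r.
  apply: eq_bigr => j _; rewrite !mxE coefXnM ltnNge leq_addr /= addKn mulrC.
  congr (_ * _); rewrite /G size_cat addn1 szT.
  have le_ik := ltn_ord i.
  have -> : (k <= (a + j).+1)%N = (i <= nu i + j)%N.
    by rewrite /a -addSn -(leq_add2r i.+1) addnC; apply/idP/idP; lia.
  by case: ifP => // le; rewrite hs_all //; congr (mcsym k _); rewrite /a; lia.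
have valS nu : sympoly_val (schur nu) = \det (JT nu).
  rewrite /schur -[LHS]/(val _) -det_map_mx; congr (\det _).
  by apply/matrixP => i j; rewrite !mxE; case: ifP.
rewrite valS -JTM det_mulmx; congr (_ * _).
have -> : \matrix_(i < k, j < k) 'X_j ^+ (k - i.+1) = JT (fun=> 0%N) *m M.
  by rewrite JTM; apply/matrixP => i j; rewrite !mxE.
rewrite det_mulmx -[X in X * _]det_tr det_trig; last first.
  by apply/is_trig_mxP => i j ltij; rewrite !mxE /= leqNgt ltij.
rewrite big1 ?mul1r // => i _; rewrite !mxE /= leqnn subnn.
by rewrite -(@hs_all (enum 'I_k)) ?hs0 // => j; rewrite mem_enum.
Qed.

End BialternantFormula.

(* [P_k^+]; the bound [m_i <= k] is automatic and makes the type finite. *)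
Definition weight (n k : nat) :=
  {m : {ffun 'I_n -> 'I_k.+1} | (\sum_i m i == k)%N}.

Definition labels n k (l : weight n k) : 'I_n -> nat := fun i => val l i.

(* The labels [(k, 0, ..., 0)]. *)
Definition vacuum n (k : nat) : 'I_n -> nat :=
  fun i => if val i == 0%N then k else 0%N.

(* [ordS (rev_ord i)] is [(n - i) %% n]. *)
Definition dual n (m : 'I_n -> nat) : 'I_n -> nat := fun i => m (ordS (rev_ord i)).

(* The index [i : 'I_n] stands for the row [i + 1], so that
   [part m i - part m (i + 1) = m_(i + 1)] and [part m (n - 1) = 0]. *)
Definition part n (m : 'I_n -> nat) : 'I_n -> nat :=
  fun i => (\sum_(j < n | i < j) m j)%N.

(* For [p = part m] with [m] of level [k] the parts are at most [k], so the
   transpose has at most [k] rows. *)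
Definition transpose_part n k (p : 'I_n -> nat) : 'I_k -> nat :=
  fun j => #|[set i | (j < p i)%N]|.

Section Verlinde.
Variable R : realType.

Definition expi (t : R) : R[i] := trigo.cos t +i* trigo.sin t.

(* Coordinates of [lambda + rho] in the basis [epsilon_i]. *)
Definition shifted n (m : 'I_n -> nat) (i : 'I_n) : R :=
  ((part m i)%:R - (\sum_j part m j)%N%:R / n%:R) + (n.+1%:R / 2 - i.+1%:R).

(* [w] acts by [epsilon_i |-> epsilon_(w i)], so the inner sum is
   [(sigma + rho, w (lambda + rho))]. *)
Definition Smatrix n (k : nat) (l s : 'I_n -> nat) : R[i] :=
  expi (trigo.pi * (n * (n - 1))%N%:R / 4)
    / (Num.sqrt (n * (k + n) ^ (n - 1))%N%:R)%:C
  * \sum_(w : 'S_n) (-1) ^+ w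
      * expi (- (2 * trigo.pi / (k + n)%N%:R
                 * \sum_i shifted s (w i) * shifted l i)).

Definition verlinde n k (l m v : weight n k) : R[i] :=
  \sum_(s : weight n k)
    Smatrix k (labels l) (labels s) * Smatrix k (labels m) (labels s)
    * Smatrix k (dual (labels v)) (labels s)
    / Smatrix k (vacuum k) (labels s).

(* The Verlinde sums are integers, so [Num.floor] only changes their type. *)
Definition fusion_coef n k (l m v : weight n k) : int :=
  Num.floor (complex.Re (verlinde l m v)).

End Verlinde.

Section Fusion.
Variables (n k : nat).

Definition fusion := {ffun weight n k -> int}.

Definition fusion_one : fusion :=
  [ffun l : weight n k => ([forall i, labels l i == vacuum k i] : nat)%:Z].

Definition fusion_mul (R : realType) (a b : fusion) : fusion :=
  [ffun v => \sum_(l : weight n k) \sum_(m : weight n k)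
               a l * b m * fusion_coef R l m v].

(* As [Q] is a commutative ring, such an [f] also transports the ring axioms to
   [fusion_mul R]. *)
Definition fusion_iso (R : realType) (Q : comPzRingType) (f : fusion -> Q) :=
  [/\ {morph f : a b / a + b},
      {morph f : a b / fusion_mul R a b >-> a * b},
      f fusion_one = 1
    & bijective f].

End Fusion.

Section Relations.
Variables (n k : nat).

Definition fusion_rels : seq (sympoly k) :=
  sym_h k n - 1
  :: [seq sym_h k (n + i)%N | i <- iota 1 k.-1]
  ++ [:: sym_h k (n + k)%N + (-1) ^+ k * sym_e k k].

(* [qH(Gr_(k, n + k))] in the Siebert-Tian presentation; [{poly sympoly k}] is
   [Z[q] (x) Z[e_1, ..., e_k]], with [q] the variable ['X]. *)
Definition qH_rels : seq {poly sympoly k} :=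
  [seq (sym_h k (n + i)%N)%:P | i <- iota 1 k.-1]
  ++ [:: (sym_h k (n + k)%N)%:P + (-1) ^+ k * 'X].

Definition qH : comPzRingType := quotring qH_rels.

Definition qH_proj : {poly sympoly k} -> qH := @quotring_proj _ qH_rels.

Definition qH_fusion_rels : seq qH :=
  [:: qH_proj ('X - (sym_e k k)%:P); qH_proj ((sym_h k n)%:P - 1)].

Definition schur_map (a : fusion n k) : quotring fusion_rels :=
  \sum_(l : weight n k)
    quotring_proj fusion_rels (schur (transpose_part (part (labels l)))) *~ a l.

End Relations.

(* Main.v *)
Require Import Defs.
From HB Require Import structures.
From mathcomp Require Import all_boot all_order all_algebra perm.
From mathcomp Require Import complex mpoly reals.
From mathcomp Require Import zify ring lra.
From mathcomp Require trigo.
From mathcomp Require generic_quotient.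
Import Order.TTheory GRing.Theory Num.Theory.
Local Open Scope ring_scope.

(** Write [N = n + k], [Q] for the quotient by [fusion_rels], and [B_l] for the
    class in [Q] of the Schur polynomial attached to the weight [l].

    The classes [B_l] span [Q].  Indeed [e_r * s_mu] is a sum of Schur
    polynomials [s_(mu + 1_S)] ([sym_e_mul_schur]), each of which is zero or
    indexed by a partition whose first part is at most [n].  If the first part
    is equal to [n], the relations turn the first row of the Jacobi-Trudi matrix
    into [(1, 0, ..., 0)], so that this part can be erased ([schur_rotate]).  As
    the [e_r] generate the symmetric polynomials, the span of the [B_l] is [Q]
    ([schur_map_surj]).

    Every weight [s] gives a complex point of [Q].  Let [X_j], for [j < n], be
    the numbers [exp (- 2 pi i (s + rho)_j / N)].  Their opposites are [n] of the
    [N] roots of an equation [z ^ N = c]; the [k] other roots [y] satisfy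
    [(-1) ^ (k - 1) * prod y = c], and any [k] distinct roots with this property
    satisfy the relations ([sym_eval_fusion_rels]).  A minor of an invertible matrix is, up to the
    determinant, the complementary minor of the inverse
    ([det_minor_mulmx1]); for the matrix of powers of the [N] roots, whose
    inverse consists of the inverse powers divided by [N], this says that the
    alternant of [y] with exponents [mu + delta] is proportional to the alternant
    of [X] with exponents [lambda + delta], where [lambda] is the transpose of
    [mu] ([alternant_ypoint]).  Dividing by the case of the vacuum, the value of
    [B_l] at the point [s] is [S_(l, s) / S_(0, s)] ([sym_eval_schur_weight]).

    The [S]-matrix satisfies [sum_s S_(l, s) S_(m*, s) = (l == m)]
    ([Smatrix_orthogonal]).  Expanding both alternants, the sum over the weights
    becomes a sum over all tuples of residues modulo [N] with one zero entry,
    which factors into geometric sums ([orthogonality_congruent]).  This needs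
    [|l|] and [|m|] to be congruent modulo [n]; otherwise the sum vanishes because
    rotating the labels of [s] multiplies its terms by a nontrivial root of unity
    ([sum_numer_incongruent]).

    Consequently the [B_l] are linearly independent.  If moreover
    [B_l * B_m = sum_v c_v * B_v] with integers [c_v], which exist by spanning,
    then evaluating at all the points and applying orthogonality gives
    [c_v = sum_s S_(l, s) S_(m, s) S_(v*, s) / S_(0, s)]
    ([verlinde_structure_constant]): the Verlinde sums are integers and are the
    structure constants of [Q].  For the quantum cohomology ring, [q] can be
    eliminated with the help of [q = e_k], which recovers [Q]. *)

Set Implicit Arguments.
Unset Strict Implicit.
Unset Printing Implicit Defensive.

(** * Signs of permutations and determinants *)

Lemma det_row_perm (R : comPzRingType) m (s : 'S_m) (A : 'M[R]_m) :
  \det (row_perm s A) = (-1) ^+ s * \det A.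
Proof. by rewrite row_permE det_mulmx det_perm. Qed.

Lemma det_col_perm (R : comPzRingType) m (s : 'S_m) (A : 'M[R]_m) :
  \det (col_perm s A) = (-1) ^+ s * \det A.
Proof. by rewrite col_permE det_mulmx det_perm odd_permV mulrC. Qed.

(** Permuting the columns of the Vandermonde matrix of [0, ..., m - 1] multiplies
    its determinant by the sign of [p], while the factor of a pair [i < j] changes
    sign exactly when [p] inverts the pair. *)
Lemma odd_perm_inversions m (p : 'S_m) :
  odd_perm p = odd (\sum_(i < m) \sum_(j < m | (i < j)%N) (p j < p i)%N).
Proof.
have signr_inj : injective (fun b : bool => (-1) ^+ b : int) by move=> [] [].
apply: signr_inj; rewrite signr_odd.
pose a : 'rV[int]_m := \row_j j%:Z.
have dV : \det (Vandermonde m (\row_j (p j)%:Z)) = (-1) ^+ p * \det (Vandermonde m a).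
  by rewrite -det_col_perm; congr (\det _); apply/matrixP => i j; rewrite !mxE.
have /(congr1 Num.sg) := dV; rewrite sgrM !det_Vandermonde.
have sgE (b : 'rV[int]_m) : Num.sg (\prod_(i < m) \prod_(j < m | (i < j)%N) (b 0 j - b 0 i))
    = \prod_(i < m) \prod_(j < m | (i < j)%N) Num.sg (b 0 j - b 0 i).
  rewrite (big_morph _ (@sgrM _) (@sgr1 _)); apply: eq_bigr => i _.
  by rewrite (big_morph _ (@sgrM _) (@sgr1 _)).
rewrite !sgE [X in _ = _ * X]big1 => [|i _]; last first.
  by rewrite big1 // => j lt_ij; rewrite !mxE gtr0_sg // subr_gt0 ltz_nat.
rewrite mulr1 sgrX sgrN1 => <-.
rewrite (expr_sum (-1)); apply: eq_bigr => i _.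
rewrite (expr_sum (-1)); apply: eq_bigr => j lt_ij; rewrite !mxE.
case: (ltngtP (p j) (p i)) => [lt|lt|/val_inj/perm_inj ji].
- by rewrite ltr0_sg // subr_lt0 ltz_nat.
- by rewrite gtr0_sg // subr_gt0 ltz_nat.
- by rewrite ji ltnn in lt_ij.
Qed.

Definition rev_perm m : 'S_m := perm (@rev_ord_inj m).

Lemma odd_rev_perm m : odd_perm (rev_perm m) = odd 'C(m, 2).
Proof.
rewrite odd_perm_inversions; congr odd.
rewrite -bin2_sum big_mkord [RHS](reindex_inj rev_ord_inj) /=.
apply: eq_bigr => i _.
under eq_bigr => j lt_ij.
  rewrite !permE /= (_ : (m - j.+1 < m - i.+1)%N = true); last first.
    by have := ltn_ord j; lia.
  over.
rewrite sum1_card -sum1_card.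
rewrite (eq_bigl (fun j : 'I_m => predT j && (~~ (j < i.+1)%N))) //; last first.
  by move=> j; rewrite -leqNgt.
have -> : (\sum_(j < m | true && ~~ (j < i.+1)) 1 = \sum_(i.+1 <= j < m) 1)%N.
  rewrite [RHS](big_nat_widenl _ 0) ?big_mkord //=.
  by apply: eq_bigl => j; rewrite -leqNgt.
by rewrite sum_nat_const_nat muln1.
Qed.

(** Jacobi's identity for complementary minors: multiply [A] by the block
    triangular matrix made of the identity and the last columns of its inverse. *)
Lemma det_minor_mulmx1 (R : comPzRingType) k n (A B : 'M[R]_(k + n)) :
  A *m B = 1%:M -> \det (ulsubmx A) = \det A * \det (drsubmx B).
Proof.
move=> AB1.
have E : A *m block_mx 1%:M (ursubmx B) 0 (drsubmx B)
       = block_mx (ulsubmx A) 0 (dlsubmx A) 1%:M.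
  rewrite -[A in LHS]submxK mulmx_block !mulmx1 !mulmx0 !addr0.
  have := AB1; rewrite -{1}[A]submxK -{1}[B]submxK mulmx_block scalar_mx_block.
  by case/eq_block_mx => _ -> _ ->.
have := congr1 determinant E.
by rewrite det_mulmx det_ublock det_lblock !det1 mul1r mulr1.
Qed.

Definition alternant (R : pzSemiRingType) m (e : 'I_m -> nat) (x : 'I_m -> R) : 'M_m :=
  \matrix_(i, j) x j ^+ e i.

Lemma det_scale_cols (R : comPzRingType) m (c : 'I_m -> R) (A : 'M[R]_m) :
  \det (\matrix_(i, j) (A i j * c j)) = \det A * \prod_j c j.
Proof.
have -> : \matrix_(i, j) (A i j * c j) = A *m diag_mx (\row_j c j).
  by apply/matrixP => i j; rewrite mul_mx_diag !mxE.
by rewrite det_mulmx det_diag; congr (_ * _); apply: eq_bigr => j _; rewrite !mxE.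
Qed.

Lemma det_scale_rows (R : comPzRingType) m (c : 'I_m -> R) (A : 'M[R]_m) :
  \det (\matrix_(i, j) (c i * A i j)) = (\prod_j c j) * \det A.
Proof.
have -> : \matrix_(i, j) (c i * A i j) = diag_mx (\row_j c j) *m A.
  by apply/matrixP => i j; rewrite mul_diag_mx !mxE.
by rewrite det_mulmx det_diag; congr (_ * _); apply: eq_bigr => j _; rewrite !mxE.
Qed.

(** Up to the reversal of the rows this is a Vandermonde determinant. *)
Lemma alternant_neq0 (R : idomainType) m (x : 'I_m -> R) :
  injective x -> \det (alternant (fun i => m - i.+1)%N x) != 0.
Proof.
move=> injx; have -> : alternant (fun i : 'I_m => m - i.+1)%N x
   = row_perm (rev_perm m) (Vandermonde m (\row_j x j)).
  by apply/matrixP => i j; rewrite !mxE permE.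
rewrite det_row_perm mulf_neq0 ?signr_eq0 // det_Vandermonde.
apply/prodf_neq0 => i _; apply/prodf_neq0 => j lt_ij; rewrite !mxE subr_eq0.
by apply/eqP => /injx eqji; rewrite eqji ltnn in lt_ij.
Qed.

(** * Schur polynomials as quotients of alternants *)

Section Symmetric.
Variable k : nat.
Local Notation A := (sympoly k).
Local Notation delta := (fun i : 'I_k => k - i.+1)%N.

Lemma schur_alternant (mu : 'I_k -> nat) :
  sympoly_val (schur mu) * \det (alternant delta (fun j => 'X_j))
  = \det (alternant (fun i => mu i + (k - i.+1))%N (fun j => 'X_j)) :> {mpoly int[k]}.
Proof. exact: schur_bialternant. Qed.

Lemma mpoly_alternant_neq0 :
  \det (alternant delta (fun j => 'X_j)) != 0 :> {mpoly int[k]}.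
Proof.
apply: alternant_neq0 => i j /(congr1 (mcoeff U_(i))).
rewrite !mcoeffX eqxx; case: eqP => // /mnmP /(_ i); rewrite !mnm1E eqxx.
by case: eqP => // ->.
Qed.

(** In the term of the permutation [w], the sets that index [e_r] can be taken to
    be the images by [w] of the sets [S]; the factor of [S] then raises by one the
    exponents of the rows in [S]. *)
Lemma mesym_mul_alternant r (a : 'I_k -> nat) :
  mesym k int r * \det (alternant a (fun j => 'X_j))
  = \sum_(S : {set 'I_k} | #|S| == r)
      \det (alternant (fun i => a i + (i \in S))%N (fun j => 'X_j)).
Proof.
rewrite /determinant mulr_sumr [RHS]exchange_big /=; apply: eq_bigr => w _.
rewrite -mulr_sumr mulrCA; congr (_ * _); rewrite /mesym mulr_suml.
have injS : injective (fun S : {set 'I_k} => w @: S) by apply: imset_inj; apply: perm_inj.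
rewrite (reindex_inj injS) /=.
apply: eq_big => [S|S _]; first by rewrite card_imset //; apply: perm_inj.
rewrite big_imset /=; last by move=> x y _ _; apply: perm_inj.
rewrite big_mkcond -big_split /=; apply: eq_bigr => i _; rewrite !mxE exprD mulrC.
by congr (_ * _); case: (i \in S); rewrite ?expr0 ?expr1.
Qed.

Lemma sym_e_mul_schur r (mu : 'I_k -> nat) :
  sym_e k r * schur mu
  = \sum_(S : {set 'I_k} | #|S| == r) schur (fun i => mu i + (i \in S))%N.
Proof.
apply: val_inj; rewrite [RHS]rmorph_sum rmorphM /=.
apply: (mulIf mpoly_alternant_neq0); rewrite -mulrA schur_alternant mesym_mul_alternant mulr_suml.
apply: eq_bigr => S _; rewrite schur_alternant; congr (\det _).
by apply/matrixP => i j; rewrite !mxE addnAC.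
Qed.

Lemma schur_eq (mu nu : 'I_k -> nat) : mu =1 nu -> schur mu = schur nu.
Proof. by move=> eqm; congr (\det _); apply/matrixP => i j; rewrite !mxE eqm. Qed.

(** The rows [i] and [i + 1] of the Jacobi-Trudi matrix coincide. *)
Lemma schur_step0 (mu : 'I_k -> nat) (i j : 'I_k) :
  j = i.+1 :> nat -> mu j = (mu i).+1 -> schur mu = 0.
Proof.
move=> ji muj; apply: (determinant_alternate (i1 := i) (i2 := j)).
  by apply/eqP => eij; move: ji; rewrite eij; lia.
move=> l; rewrite !mxE ji muj !addSn ltnS; by case: ifP.
Qed.

Lemma schur_uptrig (mu : 'I_k -> nat) :
  (forall i : 'I_k, (0 < i)%N -> mu i = 0%N) ->
  schur mu = \prod_(i < k) (sym_h k (mu i)).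
Proof.
move=> mu0; rewrite /schur -det_tr det_trig.
  by apply: eq_bigr => i _; rewrite !mxE leq_addl addnK.
apply/is_trig_mxP => i j lt_ij; rewrite !mxE mu0 ?add0n; last by lia.
by rewrite leqNgt lt_ij.
Qed.

Lemma sym_h0 : sym_h k 0 = 1.
Proof.
apply: val_inj; apply/mpolyP => m /=; rewrite mcoeff_mcsym.
by rewrite mcoeff1 mdeg_eq0.
Qed.

Lemma schur0 (mu : 'I_k -> nat) : (forall i, mu i = 0%N) -> schur mu = 1.
Proof.
move=> mu0; rewrite schur_uptrig => [|i _]; last exact: mu0.
by rewrite big1 // => i _; rewrite mu0 sym_h0.
Qed.

(** The fundamental theorem of symmetric polynomials, as an induction
    principle: a subgroup containing 1 and stable under the multiplication by each
    [e_r] is everything. *)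
Lemma sympoly_ind_e (P : A -> Prop) :
  P 1 -> (forall a b, P a -> P b -> P (a - b)) ->
  (forall r a, P a -> P (sym_e k r * a)) -> forall a, P a.
Proof.
move=> P1 PB PM.
have P0 : P 0 by rewrite -(subrr 1); apply: PB.
have PN a : P a -> P (- a) by move=> Pa; rewrite -sub0r; apply: PB.
have PD a b : P a -> P b -> P (a + b).
  by move=> Pa Pb; rewrite -[b]opprK; apply: PB => //; apply: PN.
have PZ (c : int) a : P a -> P (c%:~R * a).
  move=> Pa; rewrite mulrzl.
  have PMn m : P (a *+ m) by elim: m => [|m IH]; rewrite ?mulr0n // mulrS; apply: PD.
  by case: c => m; [apply: PMn | apply: PN; apply: PMn].
have PX r m a : P a -> P (sym_e k r ^+ m * a).
  by move=> Pa; elim: m => [|m IH]; rewrite ?mul1r // exprS -mulrA; apply: PM.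
move=> a; have [t [ta _]] := sym_fundamental (valP a).
have -> : a = \sum_(m <- msupp t) (t@_m)%:~R * \prod_(i < k) sym_e k i.+1 ^+ m i.
  apply: val_inj; rewrite -[LHS]ta comp_mpolyE rmorph_sum; apply: eq_bigr => m _.
  rewrite -mul_mpolyC rmorphM rmorph_prod; congr (_ * _).
    by rewrite -[t@_m in LHS]intz !rmorph_int.
  by apply: eq_bigr => i _; rewrite rmorphXn tnth_mktuple.
elim: (msupp t : seq _) => [|m s IHs]; rewrite ?big_nil // big_cons.
apply: PD => //; apply: PZ.
by elim/big_rec: _ => // i x _; apply: PX.
Qed.

End Symmetric.

(** * The Schur polynomials of the box span the quotient *)

Lemma quotring_proj_gen (R : comPzRingType) (gens : seq R) x :
  x \in gens -> quotring_proj gens x = 0.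
Proof.
move=> xg; rewrite -(raddf0 (quotring_proj gens)); apply/quotring_projP.
rewrite subr0; apply/boolp.asboolP.
pose i0 := Ordinal (eq_ind_r is_true xg (index_mem x gens)).
exists (fun i => (i == i0)%:R); rewrite (bigD1 i0) //= eqxx mul1r nth_index //.
by rewrite big1 ?addr0 // => i /negPf ->; rewrite mul0r.
Qed.

Lemma rmorph_ideal_gen (R S : comPzRingType) (gens : seq R) (phi : {rmorphism R -> S}) x :
  (forall y, y \in gens -> phi y = 0) -> x \in ideal_gen gens -> phi x = 0.
Proof.
move=> phi0 /boolp.asboolP[c ->]; rewrite rmorph_sum big1 // => i _.
by rewrite rmorphM (phi0 gens`_i) ?mulr0 ?mem_nth.
Qed.

Lemma weight_of_labels n k (f : 'I_n -> nat) :
  (\sum_i f i = k)%N -> exists l : weight n k, labels l =1 f.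
Proof.
move=> sumf; have lef i : (f i < k.+1)%N.
  by rewrite ltnS -sumf (bigD1 i) //= leq_addr.
pose g : {ffun 'I_n -> 'I_k.+1} := [ffun i => Ordinal (lef i)].
have sumg : (\sum_i g i == k)%N.
  by apply/eqP; rewrite -[RHS]sumf; apply: eq_bigr => i _; rewrite ffunE.
by exists (exist _ g sumg) => i; rewrite /labels /= ffunE.
Qed.

Lemma card_ord_lt k m : (m <= k)%N -> #|[set i : 'I_k | (i < m)%N]| = m.
Proof.
by move=> le; rewrite -sum1dep_card (big_ord_narrow le) /= sum1_card card_ord.
Qed.

(** With [m_j] equal to the number of parts [j] of [mu], the partition of [m] is
    the transpose of [mu]. *)
Lemma part_card n k (mu : 'I_k -> nat) (m : 'I_n -> nat) :
  (forall i, mu i < n)%N -> (forall j, m j = #|[set a | mu a == j]|) ->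
  forall i, part m i = #|[set a | (i < mu a)%N]|.
Proof.
move=> lt_mu mE i; rewrite /part.
under eq_bigr => j _ do rewrite mE -sum1dep_card big_mkcond /=.
rewrite exchange_big -sum1dep_card [RHS]big_mkcond /=; apply: eq_bigr => a _.
rewrite -big_mkcondr /=; case: ifP => lt.
  rewrite (big_pred1 (Ordinal (lt_mu a))) // => j /=.
  rewrite -val_eqE /= eq_sym; case: (eqVneq (j : nat) (mu a)) => [->|]; first by rewrite lt.
  by rewrite andbF.
rewrite big_pred0 // => j; apply/negP => /andP[lt_ij /eqP muj].
by rewrite muj lt_ij in lt.
Qed.

Lemma ltn_transpose_part m K (p : 'I_m -> nat) (i : 'I_K) (j : 'I_m) :
  (forall a b : 'I_m, a <= b -> p b <= p a)%N ->
  (j < transpose_part p i)%N = (i < p j)%N.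
Proof.
move=> dec; rewrite /transpose_part; apply/idP/idP => [|lt].
  apply: contraTT; rewrite -!leqNgt => le.
  rewrite -[leqRHS](card_ord_lt (ltnW (ltn_ord j))); apply: subset_leq_card.
  apply/subsetP => a; rewrite !inE => lt; rewrite ltnNge; apply/negP => /dec.
  by lia.
rewrite -[leqLHS](card_ord_lt (ltn_ord j)); apply: subset_leq_card.
by apply/subsetP => a; rewrite !inE ltnS => /dec; lia.
Qed.

Lemma transpose_card n k (mu : 'I_k -> nat) :
  (forall i, mu i <= n)%N -> (forall i j : 'I_k, i <= j -> mu j <= mu i)%N ->
  transpose_part (fun i : 'I_n => #|[set a | (i < mu a)%N]|) =1 mu.
Proof.
move=> le_mu dec j; rewrite {1}/transpose_part.
rewrite -[RHS](card_ord_lt (le_mu j)); apply: eq_card => i; rewrite !inE.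
exact: ltn_transpose_part.
Qed.

Lemma weight_of_columns n k (mu : 'I_k -> nat) :
  (forall i, mu i < n)%N ->
  exists l : weight n k, forall i, part (labels l) i = #|[set a | (i < mu a)%N]|.
Proof.
move=> lt_mu.
have [|l lE] := @weight_of_labels n k (fun j => #|[set a | mu a == j]|).
  under eq_bigr => j _ do rewrite -sum1dep_card big_mkcond /=.
  rewrite exchange_big /= -[RHS]card_ord -sum1_card; apply: eq_bigr => a _.
  by rewrite -big_mkcond (big_pred1 (Ordinal (lt_mu a))).
by exists l => i; rewrite (part_card lt_mu lE).
Qed.

Lemma weight_of_partition n k (mu : 'I_k -> nat) :
  (forall i, mu i < n)%N -> (forall i j : 'I_k, i <= j -> mu j <= mu i)%N ->
  exists l : weight n k, transpose_part (part (labels l)) =1 mu.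
Proof.
move=> lt_mu dec; have [l lE] := weight_of_columns lt_mu.
exists l => j; rewrite -(@transpose_card n _ _ _ dec); last by move=> i; apply: ltnW.
by congr (#|pred_of_set _|); apply/setP => i; rewrite !inE lE.
Qed.

Lemma weight_of_part n k (lam : 'I_n -> nat) (i0 : 'I_n) :
  (forall i, lam i <= k)%N -> (forall i j : 'I_n, i <= j -> lam j <= lam i)%N ->
  lam i0 = 0%N -> exists l : weight n k, part (labels l) =1 lam.
Proof.
move=> le_lam dec lam0.
have [|l lE] := @weight_of_columns n k (transpose_part lam).
  move=> a; rewrite -[ltnRHS]card_ord -cardsT; apply: proper_card.
  by apply/properP; split; [exact: subsetT | exists i0; rewrite // inE lam0].
by exists l => i; rewrite lE -(transpose_card le_lam dec).
Qed.

Section Spanning.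
Variables (n k' : nat).
Local Notation k := k'.+1.
Local Notation pi := (quotring_proj (fusion_rels n k)).
Local Notation smap := (@schur_map n k).

Lemma fusion_h_n : pi (sym_h k n) = 1.
Proof.
apply/eqP; rewrite -subr_eq0 -(rmorph1 pi) -rmorphB; apply/eqP.
by apply: quotring_proj_gen; rewrite inE eqxx.
Qed.

Lemma fusion_h_gt_n i : (0 < i < k)%N -> pi (sym_h k (n + i)) = 0.
Proof.
move=> i_bnd; apply: quotring_proj_gen; rewrite inE mem_cat; apply/orP; right.
apply/orP; left; apply/mapP; exists i => //; rewrite mem_iota; lia.
Qed.

Definition rotate_part (mu : 'I_k -> nat) (i : 'I_k) : nat :=
  if (i < k')%N then mu (inord i.+1) else 0%N.

(** Both determinants reduce to the same minor: the relations make the first row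
    on the left equal to [(1, 0, ..., 0)], and the last row on the right, that of
    an empty part, is [(0, ..., 0, 1)]. *)
Lemma schur_rotate (mu : 'I_k -> nat) :
  mu ord0 = n -> pi (schur mu) = pi (schur (rotate_part mu)).
Proof.
move=> mu0; rewrite /schur -!det_map_mx.
rewrite (expand_det_row _ ord0) (bigD1 ord0) //= big1 ?addr0 => [|j j0]; last first.
  rewrite !mxE mu0 leq0n subn0 fusion_h_gt_n ?mul0r //.
  by have := ltn_ord j; rewrite -val_eqE /= in j0; lia.
rewrite !mxE mu0 leq0n addn0 subn0 fusion_h_n mul1r.
rewrite [RHS](expand_det_row _ ord_max) (bigD1 ord_max) //=.
rewrite [X in _ = _ + X]big1 ?addr0 => [|j jm]; last first.
  rewrite !mxE {1}/rotate_part ltnn add0n leqNgt.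
  have := ltn_ord j; rewrite -val_eqE /= in jm; rewrite ltnS leq_eqVlt (negPf jm) /= => ->.
  by rewrite raddf0 mul0r.
rewrite !mxE {1 2}/rotate_part ltnn add0n leqnn subnn sym_h0 rmorph1 mul1r.
rewrite /cofactor addn0 expr0 mul1r addnn -mul2n exprM sqrrN expr1n expr1n mul1r.
congr (\det _); apply/matrixP => i j; rewrite !mxE.
have -> : rotate_part mu (lift ord_max i) = mu (lift ord0 i).
  rewrite /rotate_part lift_max ltn_ord; congr mu; apply: val_inj.
  by rewrite /= inordK // ltnS.
by rewrite !lift_max !lift0 addnS ltnS subSS.
Qed.

Definition span_schur (q : quotring (fusion_rels n k)) := exists a, smap a = q.

Lemma schur_mapB a b : smap (a - b) = smap a - smap b.
Proof.
rewrite /schur_map -sumrB; apply: eq_bigr => l _.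
by rewrite !ffunE mulrzBr.
Qed.

Definition delta_weight (l : weight n k) : fusion n k := [ffun m => (m == l)%:R].

Lemma schur_map_delta l : smap (delta_weight l) = pi (schur (transpose_part (part (labels l)))).
Proof.
rewrite /schur_map (bigD1 l) //= ffunE eqxx mulr1z big1 ?addr0 // => m ne.
by rewrite ffunE (negPf ne) mulr0z.
Qed.

Hypothesis n_gt0 : (0 < n)%N.

(** A first part equal to [n] can be erased by [schur_rotate], which decreases
    the size; partitions with all parts less than [n] come from weights. *)
Lemma span_schur_partition (mu : 'I_k -> nat) :
  (mu ord0 <= n)%N -> (forall i j : 'I_k, i <= j -> mu j <= mu i)%N ->
  span_schur (pi (schur mu)).
Proof.
have [s] := ubnP (\sum_i mu i)%N; elim: s => // s IHs in mu *.
rewrite ltnS => les mu0 dec; move: mu0; rewrite leq_eqVlt => /predU1P[mu0|mu0].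
  rewrite schur_rotate //.
  have sumE : (\sum_i rotate_part mu i + n = \sum_i mu i)%N.
    rewrite big_ord_recr [RHS]big_ord_recl /= mu0 addnC {2}/rotate_part ltnn addn0.
    congr (_ + _)%N; apply: eq_bigr => i _; rewrite /rotate_part /= ltn_ord.
    by congr mu; apply: val_inj; rewrite /= inordK // ltnS.
  apply: IHs => [||i j le_ij]; first by lia.
    rewrite /rotate_part; case: ifP => // _; rewrite -mu0; apply: dec; exact: leq0n.
  rewrite /rotate_part; case: ltnP => // lt; rewrite (leq_ltn_trans le_ij lt).
  by apply: dec; rewrite !inordK; lia.
have lt_mu i : (mu i < n)%N by apply: leq_ltn_trans mu0; apply: dec.
have [l lE] := weight_of_partition lt_mu dec.
by exists (delta_weight l); rewrite schur_map_delta (schur_eq lE).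
Qed.

Lemma span_schurB a b : span_schur a -> span_schur b -> span_schur (a - b).
Proof. by move=> [x <-] [y <-]; exists (x - y); rewrite schur_mapB. Qed.

Lemma span_schur0 : span_schur 0.
Proof. by exists 0; rewrite /schur_map big1 // => l _; rewrite ffunE mulr0z. Qed.

Lemma span_schurD a b : span_schur a -> span_schur b -> span_schur (a + b).
Proof.
move=> sa sb; rewrite -[b]opprK; apply: span_schurB => //.
by rewrite -sub0r; apply: span_schurB => //; apply: span_schur0.
Qed.

Lemma span_schur_sum (I : Type) (s : seq I) (P : pred I) F :
  (forall i, P i -> span_schur (F i)) -> span_schur (\sum_(i <- s | P i) F i).
Proof.
move=> sF; elim/big_rec: _ => [|i x Pi sx]; first exact: span_schur0.
by apply: span_schurD; first apply: sF.
Qed.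

Lemma span_schurMz a (c : int) : span_schur a -> span_schur (a *~ c).
Proof.
move=> sa; have sn m : span_schur (a *+ m).
  elim: m => [|m IHm]; first by rewrite mulr0n; apply: span_schur0.
  by rewrite mulrS; apply: span_schurD.
case: c => m; first exact: sn.
by rewrite NegzE mulrNz -sub0r; apply: span_schurB; [apply: span_schur0 | apply: sn].
Qed.

Lemma part_noninc m (f : 'I_m -> nat) (i j : 'I_m) : (i <= j)%N -> (part f j <= part f i)%N.
Proof.
move=> le; rewrite /part [leqLHS]big_mkcond [leqRHS]big_mkcond /=.
apply: leq_sum => a _; case: ifP => // lt; rewrite ifT //.
exact: leq_ltn_trans lt.
Qed.

Lemma transpose_noninc m K (p : 'I_m -> nat) (i j : 'I_K) :
  (i <= j)%N -> (transpose_part p j <= transpose_part p i)%N.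
Proof.
move=> le; apply: subset_leq_card; apply/subsetP => a; rewrite !inE.
exact: leq_ltn_trans.
Qed.

Lemma transpose_ltn (l : weight n k) (i : 'I_k) :
  (transpose_part (part (labels l)) i < n)%N.
Proof.
rewrite /transpose_part -[ltnRHS]card_ord -cardsT; apply: proper_card.
have lt : (n.-1 < n)%N by lia.
apply/properP; split; first exact: subsetT.
exists (Ordinal lt); rewrite // inE /part big_pred0 // => j /=.
by have := ltn_ord j; lia.
Qed.

(** Adding a set [S] of boxes to a partition, at most one per row, destroys the
    monotonicity only by creating consecutive rows as in [schur_step0], in which
    case the Schur polynomial is zero; otherwise the first part is at most [n]. *)
Lemma span_schur_e r a : span_schur a -> span_schur (pi (sym_e k r) * a).
Proof.
move=> [x <-]; rewrite /schur_map mulr_sumr; apply: span_schur_sum => l _.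
rewrite mulrzAr; apply: span_schurMz.
rewrite -rmorphM sym_e_mul_schur rmorph_sum; apply: span_schur_sum => S _ /=.
set mu := transpose_part _.
have mu_dec (i j : 'I_k) : (i <= j)%N -> (mu j <= mu i)%N by apply: transpose_noninc.
case: (boolP [exists i : 'I_k, exists j : 'I_k, (j == i.+1 :> nat)
          && (mu j + (j \in S) == (mu i + (i \in S)).+1)%N]).
  case/existsP=> i /existsP[j /andP[/eqP ji /eqP mui]].
  by rewrite (schur_step0 ji mui) raddf0; apply: span_schur0.
move=> noStep; apply: span_schur_partition.
  by have := transpose_ltn l ord0; rewrite -/mu; case: (_ \in S); rewrite /=; lia.
have step (i j : 'I_k) : j = i.+1 :> nat ->
    (mu j + (j \in S) <= mu i + (i \in S))%N.
  move=> ji; have := mu_dec i j; rewrite ji leqnSn => /(_ isT) le.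
  have : (mu j + (j \in S) != (mu i + (i \in S)).+1)%N.
    apply: contra noStep => E; apply/existsP; exists i; apply/existsP; exists j.
    by rewrite E ji eqxx.
  by case: (j \in S) (i \in S) => -[] /=; lia.
move=> i j; have [d] := ubnP (j - i); elim: d => // d IHd in j *.
rewrite ltnS => led; rewrite leq_eqVlt => /predU1P[/val_inj -> //|lt].
have lt_j : (j.-1 < k)%N by have := ltn_ord j; lia.
apply: (@leq_trans (mu (Ordinal lt_j) + (Ordinal lt_j \in S))); last first.
  by apply: IHd => /=; lia.
by apply: step => /=; lia.
Qed.

Lemma schur_map_surj q : exists a, smap a = q.
Proof.
have [x <-] := quotring_proj_surj q; elim/sympoly_ind_e: x => [|x y|r x].
- rewrite -(@schur0 k (fun=> 0%N)) //; apply: span_schur_partition => //.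
- by rewrite rmorphB; apply: span_schurB.
- by rewrite rmorphM; apply: span_schur_e.
Qed.

End Spanning.

(** * The S-matrix as an alternant in roots of unity *)

Lemma intr_sum_nat (R : pzRingType) m (F : 'I_m -> nat) :
  (\sum_i (F i)%:Z)%:~R = (\sum_i F i)%N%:R :> R.
Proof. by rewrite natr_sum (rmorph_sum (intmul 1)). Qed.

Section Expi.
Variable R : realType.
Local Notation pi := (trigo.pi : R).

Lemma expiD (a b : R) : expi (a + b) = expi a * expi b.
Proof.
rewrite /expi trigo.cosD trigo.sinD; apply/eqP; rewrite eq_complex /=.
by apply/andP; split; apply/eqP; ring.
Qed.

Lemma expi0 : expi 0 = 1 :> R[i].
Proof. by rewrite /expi trigo.cos0 trigo.sin0. Qed.

Lemma expi_neq0 (a : R) : expi a != 0.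
Proof.
apply/eqP => a0; have := expi0; rewrite -(addrN a) expiD a0 mul0r.
by move/esym/eqP; rewrite oner_eq0.
Qed.

Lemma expiN (a : R) : expi (- a) = (expi a)^-1.
Proof. by apply: (mulfI (expi_neq0 a)); rewrite -expiD addrN expi0 divff ?expi_neq0. Qed.

Lemma expiMn (a : R) m : expi (a * m%:R) = expi a ^+ m.
Proof.
elim: m => [|m IHm]; rewrite ?mulr0 ?expi0 // -[m.+1]addn1 natrD.
by rewrite mulrDr mulr1 expiD IHm addn1 exprSr.
Qed.

Lemma expi_pi : expi pi = -1.
Proof.
by apply/eqP; rewrite /expi trigo.cospi trigo.sinpi eq_complex /= oppr0 !eqxx.
Qed.

(** If the cosine of [a] is 1 then the sine of [a / 2] vanishes. *)
Lemma expi_neq1 (a : R) : 0 < a < 2 * pi -> expi a != 1.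
Proof.
move=> a_bnd; apply/eqP => /(congr1 (@complex.Re R)) /= cosa.
have sa : 0 < trigo.sin (a / 2) by apply: trigo.sin_gt0_pi; lra.
have := trigo.cos_mulr2n (a / 2).
rewrite -[a / 2 *+ 2]mulr_natr divfK ?pnatr_eq0 // cosa trigo.cos2sin2.
move: sa; set s := trigo.sin _; nra.
Qed.

(** The fraction [t / N] of a full turn: [turn N 1] is a primitive [N]-th root
    of unity. *)
Definition turn (N : nat) (t : R) : R[i] := expi (2 * pi / N%:R * t).

Variable N : nat.
Hypothesis N_gt0 : (0 < N)%N.

Let N_neq0 : N%:R != 0 :> R.
Proof. by rewrite pnatr_eq0 -lt0n. Qed.

Lemma turnD a b : turn N (a + b) = turn N a * turn N b.
Proof. by rewrite /turn mulrDr expiD. Qed.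

Lemma turn0 : turn N 0 = 1.
Proof. by rewrite /turn mulr0 expi0. Qed.

Lemma turnN a : turn N (- a) = (turn N a)^-1.
Proof. by rewrite /turn mulrN expiN. Qed.

Lemma turn_neq0 a : turn N a != 0.
Proof. exact: expi_neq0. Qed.

Lemma turnMn a m : turn N (a * m%:R) = turn N a ^+ m.
Proof. by rewrite /turn mulrA expiMn. Qed.

Lemma turn_sum I (s : seq I) (P : pred I) (F : I -> R) :
  turn N (\sum_(i <- s | P i) F i) = \prod_(i <- s | P i) turn N (F i).
Proof. by apply: big_morph; [apply: turnD | apply: turn0]. Qed.

Lemma turn_full : turn N N%:R = 1.
Proof.
by rewrite /turn divfK // mulrC expiMn expi_pi sqrrN expr1n.
Qed.

Lemma turn_int (z : int) : turn N (z%:~R * N%:R) = 1.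
Proof.
rewrite turnMn; case: z => m.
  by rewrite -turnMn mulrC turnMn turn_full expr1n.
by rewrite NegzE mulrNz -turnMn mulNr turnN mulrC turnMn turn_full expr1n invr1.
Qed.

Lemma turn_eq1 (z : int) : (turn N z%:~R == 1) = (N%:Z %| z)%Z.
Proof.
apply/idP/idP => [|/dvdzP[q ->]]; last by rewrite intrM turn_int.
apply: contraLR => ndvd.
rewrite (divz_eq z N) intrD intrM turnD turn_int mul1r.
have m0 : (z %% N != 0)%Z by apply: contra ndvd => /eqP m0; apply/dvdz_mod0P.
have ge0 : 0 <= (z %% N)%Z by apply: modz_ge0; lia.
have ltN : (z %% N)%Z < N by apply: ltz_pmod; lia.
move: m0 ge0 ltN; set r := (z %% N)%Z => m0 ge0 ltN; apply: expi_neq1.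
have r_gt0 : 0 < r%:~R :> R by rewrite ltr0z lt_def m0.
have r_ltN : r%:~R < N%:R :> R by rewrite -[N%:R]/(N%:Z%:~R) ltr_int.
have N_pos : 0 < N%:R :> R by rewrite ltr0n.
have pi_pos : 0 < pi by apply: trigo.pi_gt0.
rewrite mulr_gt0 ?divr_gt0 ?mulr_gt0 //=.
by rewrite mulrAC ltr_pdivrMr // ltr_pM2l // mulr_gt0.
Qed.

Lemma sum_turn (z : int) :
  \sum_(x < N) turn N (x%:R * z%:~R) = if (N%:Z %| z)%Z then N%:R else 0.
Proof.
under eq_bigr do rewrite mulrC turnMn.
rewrite -turn_eq1; case: eqP => [->|/eqP z1].
  under eq_bigr do rewrite expr1n.
  by rewrite sumr_const card_ord.
apply: (mulfI (x := turn N z%:~R - 1)); first by rewrite subr_eq0.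
by rewrite mulr0 -subrX1 -turnMn turn_int subrr.
Qed.

End Expi.

(** The beta-numbers [lambda_i + n - i] (for [i] starting at 1): the coordinates of
    [lambda + rho] up to a common shift that makes them natural numbers. *)
Definition beta n (l : 'I_n -> nat) (i : 'I_n) : nat := (part l i + (n - i.+1))%N.

Lemma dvdz_ltn_eq (N a b : nat) : (a < N)%N -> (b < N)%N ->
  (N%:Z %| a%:Z - b%:Z)%Z = (a == b).
Proof.
move=> lt_a lt_b; apply/idP/eqP => [|->]; last by rewrite subrr dvdz0.
case/dvdzP=> q E; have [q_lt0|q_gt0|q0] := ltrgtP q 0; last by rewrite q0 in E; lia.
  have : q * N%:Z <= - N%:Z by nia.
  by lia.
have : N%:Z <= q * N%:Z by nia.
by lia.
Qed.

Lemma turn_nat_inj (R : realType) N a b : (a < N)%N -> (b < N)%N ->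
  turn N (a%:R : R) = turn N b%:R -> a = b.
Proof.
move=> lt_a lt_b E; apply/eqP; rewrite -(dvdz_ltn_eq lt_a lt_b).
rewrite -(turn_eq1 R); last by lia.
by rewrite intrB -!pmulrn turnD turnN E divff ?turn_neq0.
Qed.

Lemma double_bin2 m : ('C(m, 2) * 2 = m * (m - 1))%N.
Proof. by rewrite mulnC -mul_bin_diag bin1 subn1. Qed.

Section Smatrix.
Variables (R : realType) (n k : nat).
Hypothesis n_gt0 : (0 < n)%N.
Local Notation N := (k + n)%N.
Let n_neq0 : n%:R != 0 :> R.
Proof. by rewrite pnatr_eq0 -lt0n. Qed.

(** The common shift between [lambda + rho] and the beta-numbers, i.e. the mean
    of the latter. *)
Definition center (l : 'I_n -> nat) : R := (\sum_j part l j)%N%:R / n%:R + (n%:R - 1) / 2.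

Lemma shifted_beta (l : 'I_n -> nat) i : shifted R l i = (beta l i)%:R - center l.
Proof.
rewrite /shifted /beta /center natrD natrB // -(natr1 n) -(natr1 i).
set a := (_ / n%:R); set b := (part l i)%:R; set c := n%:R; set d := (i%:R : R).
lra.
Qed.

Lemma sum_shifted (l : 'I_n -> nat) : \sum_i shifted R l i = 0.
Proof.
under eq_bigr do rewrite shifted_beta natrD.
rewrite sumrB big_split /= sumr_const card_ord /center -natr_sum.
have -> : \sum_(i < n) (n - i.+1)%N%:R = n%:R * (n%:R - 1) / 2 :> R.
  rewrite (reindex_inj rev_ord_inj) /=.
  under eq_bigr => i _ do rewrite subnSK // subKn 1?ltnW //.
  rewrite -natr_sum -[(\sum_(i < n) i)%N](big_mkord xpredT id) bin2_sum.
  apply: canRL (mulfK _) _; first by rewrite pnatr_eq0.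
  by rewrite -natrM double_bin2 natrM natrB.
rewrite -mulr_natr; field; exact: n_neq0.
Qed.

(** The numbers [X_j] attached to the weight [s]. *)
Definition point (s : 'I_n -> nat) (j : 'I_n) : R[i] := turn N (- shifted R s j).

(** The numerator of the Weyl character formula at [point s].  The exponents can
    be natural numbers because the product of the [point s j] is 1. *)
Definition numer (l s : 'I_n -> nat) : R[i] := \det (alternant (beta l) (point s)).

(** The complex conjugate of [numer], as the points are on the unit circle. *)
Definition numer_inv (l s : 'I_n -> nat) : R[i] :=
  \det (alternant (beta l) (fun j => (point s j)^-1)).

Definition prefactor : R[i] :=
  expi (trigo.pi * (n * (n - 1))%N%:R / 4)
    / (Num.sqrt (n * (k + n) ^ (n - 1))%N%:R : R)%:C%C.

Lemma prod_point s : \prod_j point s j = 1.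
Proof.
by rewrite -turn_sum sumrN sum_shifted oppr0 turn0.
Qed.

(** A common shift of the coordinates of [lambda + rho] does not change the
    pairing with [sigma + rho], whose coordinates have sum 0. *)
Lemma Smatrix_numer l s : Smatrix R k l s = prefactor * numer l s.
Proof.
congr (_ * _); rewrite /numer /determinant; apply: eq_bigr => w _; congr (_ * _).
transitivity (turn N (- \sum_i shifted R s (w i) * shifted R l i)).
  by rewrite /turn mulrN.
have -> : \sum_i shifted R s (w i) * shifted R l i
        = \sum_i shifted R s (w i) * (beta l i)%:R.
  have sw0 : \sum_i shifted R s (w i) = 0.
    by rewrite -[RHS](sum_shifted s) [RHS](reindex_inj (@perm_inj _ w)).
  have swc : \sum_i shifted R s (w i) * center l = 0 by rewrite -mulr_suml sw0 mul0r.
  rewrite -[RHS]subr0 -[X in _ - X]swc -sumrB; apply: eq_bigr => i _.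
  by rewrite (shifted_beta l) mulrBr.
rewrite -sumrN turn_sum; apply: eq_bigr => i _.
by rewrite -mulNr turnMn mxE.
Qed.

(** In the partition of the dual weight, the rows are the complements in the
    first row, in the reverse order. *)
Lemma part_dual (l : 'I_n -> nat) i :
  (part (dual l) i + part l (rev_ord i) = part l (Ordinal n_gt0))%N.
Proof.
rewrite /part /dual (reindex_inj rev_ord_inj) /= (reindex_inj (@ord_pred_inj n)) /=.
rewrite [RHS]big_mkcond [X in (X + _)%N]big_mkcond [X in (_ + X)%N]big_mkcond -big_split /=.
apply: eq_bigr => j _; rewrite rev_ordK ord_predK.
have := ltn_ord i; have := ltn_ord j; case: (posnP j) => [->|j_gt0] lt_jn lt_in.
  rewrite add0n modn_small ?ltnn; last by lia.
  by rewrite prednK // subnn.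
have -> : ((j + n).-1 %% n = j.-1)%N by rewrite -subn1 addnC -addnBA // modnDl modn_small; lia.
by case: ltnP => h1; case: ltnP => h2 //; lia.
Qed.

(** The beta-numbers of the dual are the reversed complements of those of [l],
    whence inverse powers, and the sign of the reversal. *)
Lemma Smatrix_dual l s :
  Smatrix R k (dual l) s = prefactor * ((-1) ^+ 'C(n, 2) * numer_inv l s).
Proof.
rewrite Smatrix_numer; congr (_ * _).
have bE i : (beta (dual l) i + beta l (rev_ord i) = beta l (Ordinal n_gt0))%N.
  have := part_dual l i; rewrite /beta /=; have := ltn_ord i; lia.
rewrite /numer -(signr_odd _ 'C(n, 2)) -odd_rev_perm -det_row_perm.
rewrite -[RHS]mulr1 -(expr1n _ (beta l (Ordinal n_gt0))) -(prod_point s) -prodrXl -det_scale_cols.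
congr (\det _); apply/matrixP => i j; rewrite !mxE permE -(bE i) addnC exprD mulrA.
by rewrite -exprMn mulVf ?turn_neq0 // expr1n mul1r.
Qed.

(** The phase of the prefactor is chosen so as to cancel the sign of
    [Smatrix_dual]. *)
Lemma prefactor_sqr :
  prefactor ^+ 2 * (-1) ^+ 'C(n, 2) = ((n * N ^ (n - 1))%N%:R)^-1.
Proof.
rewrite /prefactor exprMn exprVn -rmorphXn sqr_sqrtr ?ler0n // rmorph_nat.
rewrite mulrAC -expiMn.
have -> : trigo.pi * (n * (n - 1))%N%:R / 4 * 2 = trigo.pi * ('C(n, 2))%:R :> R.
  by rewrite -double_bin2 natrM; field.
by rewrite expiMn expi_pi -exprMn mulrNN mulr1 expr1n mul1r.
Qed.

End Smatrix.

Lemma beta_decr n k (s : weight n k) (i j : 'I_n) :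
  (i < j)%N -> (beta (labels s) j < beta (labels s) i)%N.
Proof.
move=> lt; have := part_noninc (labels s) (ltnW lt); rewrite /beta.
by have := ltn_ord j; lia.
Qed.

Lemma part_le_level n k (s : weight n k) i : (part (labels s) i <= k)%N.
Proof.
have /eqP {2}<- := valP s; rewrite /part big_mkcond /=.
by apply: leq_sum => j _; case: ifP.
Qed.

Lemma beta_lt n k (s : weight n k) i : (beta (labels s) i < k + n)%N.
Proof. by have := part_le_level s i; have := ltn_ord i; rewrite /beta; lia. Qed.

Lemma beta_last n k (s : weight n k) (i : 'I_n) : i.+1 = n -> beta (labels s) i = 0%N.
Proof.
move=> i1n; rewrite /beta i1n subnn addn0 /part big_pred0 // => j.
by rewrite -ltnS i1n ltnNge ltn_ord.
Qed.

Lemma beta_ord_inj n k (s : weight n k) : injective (beta (labels s)).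
Proof.
move=> i j eqb; apply: val_inj.
by case: (ltngtP i j) => // /(beta_decr s); rewrite eqb ltnn.
Qed.

Lemma pointE (R : realType) n k (s : 'I_n -> nat) j :
  point R k s j = turn (k + n) (center R s) / turn (k + n) (beta s j)%:R.
Proof. by rewrite /point shifted_beta opprB turnD turnN. Qed.

Lemma point_inj (R : realType) n k (s : weight n k) :
  injective (point R k (labels s)).
Proof.
move=> i j; rewrite !pointE => /(mulfI (turn_neq0 _ _))/invr_inj/turn_nat_inj E.
by apply: (@beta_ord_inj _ _ s); apply: E; apply: beta_lt.
Qed.

(** * Weights as strictly decreasing sequences *)

Definition decreasing n (b : 'I_n -> nat) := forall i j : 'I_n, (i < j)%N -> (b j < b i)%N.

Lemma decreasing_ltn n (b : 'I_n -> nat) i j : decreasing b -> (b i < b j)%N = (j < i)%N.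
Proof.
move=> dec; case: (ltngtP i j) => [/dec|/dec -> //|/val_inj ->]; last by rewrite ltnn.
by move=> lt; apply/negbTE; rewrite -leqNgt ltnW.
Qed.

(** This makes the permutation that sorts a sequence in decreasing order unique. *)
Lemma decreasing_rank n (b : 'I_n -> nat) i :
  decreasing b -> #|[set j | (b i < b j)%N]| = i.
Proof.
move=> dec; rewrite -[RHS](card_ord_lt (ltnW (ltn_ord i))); apply: eq_card => j.
by rewrite !inE decreasing_ltn.
Qed.

Lemma decreasing_perm n (b b' : 'I_n -> nat) (w : 'S_n) :
  decreasing b -> decreasing b' -> (forall j, b (w j) = b' j) -> w = 1%g.
Proof.
move=> decb decb' bw; apply/permP => i; rewrite perm1; apply: val_inj.
rewrite /= -(decreasing_rank (w i) decb) -(decreasing_rank i decb').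
rewrite -[RHS](card_imset _ (@perm_inj _ w)); apply: eq_card => j; rewrite inE -(permKV w j).
by rewrite (mem_imset _ _ (@perm_inj _ w)) inE !bw.
Qed.

Lemma decreasing_gap n (b : 'I_n -> nat) (i j : 'I_n) :
  decreasing b -> (i <= j)%N -> (b j + (j - i) <= b i)%N.
Proof.
move=> dec; have [d] := ubnP (j - i); elim: d => // d IHd in j *.
rewrite ltnS => led; rewrite leq_eqVlt => /predU1P[/val_inj ->|lt].
  by rewrite subnn addn0.
have lt_j : (j.-1 < n)%N by have := ltn_ord j; lia.
have /= := IHd (Ordinal lt_j); have /= := dec (Ordinal lt_j) j; lia.
Qed.

Lemma beta_decreasing n k (s : weight n k) : decreasing (beta (labels s)).
Proof. by move=> i j; apply: beta_decr. Qed.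

Lemma part_step n (f : 'I_n -> nat) (i j : 'I_n) :
  j = i.+1 :> nat -> (part f i = f j + part f j)%N.
Proof.
move=> ji; rewrite /part (bigD1 j) /=; last by rewrite ji.
congr (_ + _)%N; apply: eq_bigl => a; rewrite ji -val_eqE /= ji; lia.
Qed.

Lemma part_level n k (s : weight n k) (i : 'I_n) :
  i = 0%N :> nat -> (labels s i + part (labels s) i = k)%N.
Proof.
move=> i0; apply: etrans (eqP (valP s)); rewrite [RHS](bigD1 i) //=; congr (_ + _)%N.
by apply: eq_bigl => a; rewrite -val_eqE /= i0 lt0n.
Qed.

Lemma beta_weight_inj n k (s t : weight n k) : beta (labels s) =1 beta (labels t) -> s = t.
Proof.
move=> eqb; have eqp i : part (labels s) i = part (labels t) i.
  by have := eqb i; rewrite /beta => /addIn.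
apply/val_inj/ffunP => i; apply: val_inj; rewrite -![val (_ i)]/(labels _ i).
case: (posnP i) => [i0|i_gt0].
  by apply: (@addIn (part (labels s) i)); rewrite {2}eqp !part_level.
have lt : (i.-1 < n)%N by have := ltn_ord i; lia.
have ii : i = (Ordinal lt).+1 :> nat by rewrite /= prednK.
by apply: (@addIn (part (labels s) i)); rewrite {2}eqp -!(part_step _ ii) eqp.
Qed.

Lemma weight_of_beta n k (b : 'I_n -> nat) (i0 : 'I_n) :
  decreasing b -> (forall i, b i < k + n)%N -> i0.+1 = n -> b i0 = 0%N ->
  exists s : weight n k, beta (labels s) =1 b.
Proof.
move=> dec lt_b i0n b0.
have gap i j := @decreasing_gap _ b i j dec.
have gap0 (i : 'I_n) : (n - i.+1 <= b i)%N.
  by have := gap i i0; have := ltn_ord i; rewrite b0; lia.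
have [|||s sE] := @weight_of_part n k (fun i => b i - (n - i.+1))%N i0.
- move=> i; have lt0 : (0 < n)%N by rewrite -i0n.
  by have := gap (Ordinal lt0) i; have := lt_b (Ordinal lt0); have := ltn_ord i => /=; lia.
- by move=> i j le; have := gap i j le; have := ltn_ord j; lia.
- by rewrite b0.
by exists s => i; rewrite /beta sE subnK.
Qed.

Section Tuples.
Variables (n k : nat).
Hypothesis n_gt0 : (0 < n)%N.
Local Notation N := (k + n)%N.

Definition beta_tuple (p : weight n k * 'S_n) : {ffun 'I_n -> 'I_N} :=
  [ffun j => Ordinal (beta_lt p.1 (p.2 j))].

Lemma beta_tupleE p j : beta_tuple p j = beta (labels p.1) (p.2 j) :> nat.
Proof. by rewrite ffunE. Qed.

Lemma beta_tuple_inj : injective beta_tuple.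
Proof.
move=> [s w] [t v] E.
have E' j : beta (labels s) ((v^-1 * w)%g j) = beta (labels t) j.
  by rewrite permM -(beta_tupleE (s, w)) E beta_tupleE /= permKV.
have vw1 := decreasing_perm (@beta_decreasing _ _ s) (@beta_decreasing _ _ t) E'.
have -> : w = v by rewrite -[w]mul1g -(mulgV v) -mulgA vw1 mulg1.
by congr (_, _); apply: beta_weight_inj => j; rewrite -E' vw1 perm1.
Qed.

(** Sort [f] in decreasing order; the zero entry comes last, as it must for the
    beta-numbers of a weight. *)
Lemma beta_tuple_surj (f : {ffun 'I_n -> 'I_N}) i0 :
  injective f -> f i0 = 0%N :> nat -> exists p, beta_tuple p = f.
Proof.
move=> injf f0.
(* [r j] is the index of [f j] in the sorted sequence *)
pose r j := #|[set i | (f j < f i)%N]|.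
have lt_r j : (r j < n)%N.
  rewrite -[ltnRHS]card_ord -cardsT; apply: proper_card.
  by apply/properP; split; [exact: subsetT | exists j; rewrite // inE ltnn].
have r_lt i j : (f i < f j)%N -> (r j < r i)%N.
  move=> lt; apply: proper_card; apply/properP; split.
    by apply/subsetP => a; rewrite !inE; apply: ltn_trans.
  by exists j; rewrite !inE ?ltnn.
have r_inj : injective (fun j => Ordinal (lt_r j)).
  move=> i j [] rij; apply/injf/val_inj.
  by case: (ltngtP (f i) (f j)) => // /r_lt; rewrite rij ltnn.
pose w := perm r_inj; pose b j : nat := f (w^-1%g j).
have rE j : r j = w j by rewrite permE.
have r_w j : r (w^-1%g j) = j by rewrite rE permKV.
have dec : decreasing b.
  move=> i j lt_ij; rewrite /b; case: (ltngtP (f (w^-1%g j)) (f (w^-1%g i))) => //.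
    by move/r_lt; rewrite !r_w ltnNge ltnW.
  by move/val_inj/injf/perm_inj => ji; rewrite ji ltnn in lt_ij.
have lt1 : (n.-1 < n)%N by lia.
have b0 : b (Ordinal lt1) = 0%N.
  have := @decreasing_gap _ b (w i0) (Ordinal lt1) dec; rewrite {2}/b permK f0 /=.
  by have := ltn_ord (w i0); lia.
have [|s sE] := weight_of_beta dec (fun i => ltn_ord _) _ b0; first by rewrite /= prednK.
by exists (s, w); apply/ffunP => j; apply: val_inj; rewrite [LHS]beta_tupleE /= sE /b permK.
Qed.

(** An injective tuple has at most one zero entry, and then it is a permutation of
    the beta-numbers of exactly one weight. *)
Lemma sum_beta_tuples (V : zmodType) (G : {ffun 'I_n -> 'I_N} -> V) :
  (forall f : {ffun _}, ~~ injectiveb f -> G f = 0) ->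
  \sum_i \sum_(f : {ffun 'I_n -> 'I_N} | f i == 0%N :> nat) G f
  = \sum_(s : weight n k) \sum_w G (beta_tuple (s, w)).
Proof.
move=> G0; rewrite pair_big /=.
transitivity (\sum_(f in beta_tuple @: setT) G f); last first.
  by rewrite big_imset /= => [|x y _ _ /beta_tuple_inj //]; apply: eq_big => [p|[]]; rewrite ?inE.
rewrite (exchange_big_dep xpredT) //= [RHS]big_mkcond; apply: eq_bigr => f _.
case: (boolP (injectiveb f)) => [/injectiveP injf|ninj]; last first.
  by rewrite G0 // if_same big1.
case: ifP => [/imsetP[[s w] _ ->]|nim].
  have lt1 : (n.-1 < n)%N by lia.
  rewrite (big_pred1 (w^-1%g (Ordinal lt1))) // => i; rewrite beta_tupleE /=.
  rewrite -(inj_eq (@perm_inj _ w)) permKV.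
  apply/eqP/eqP => [E|->]; last by rewrite beta_last //= prednK.
  apply: (@beta_ord_inj _ _ s); rewrite E beta_last //= prednK //.
rewrite big_pred0 // => i; apply/negP => /eqP fi0.
have [p pf] := beta_tuple_surj injf fi0; move/negP: nim; apply.
by rewrite -pf imset_f.
Qed.

End Tuples.

(** * Orthogonality of the S-matrix *)

Section Orthogonality.
Variables (R : realType) (n k : nat).
Hypothesis n_gt0 : (0 < n)%N.
Local Notation N := (k + n)%N.
Local Notation beta l := (beta (labels l)).
Implicit Types (l m s : weight n k).

Let N_gt0 : (0 < N)%N. Proof. lia. Qed.

(** Put [z_j = beta l j - beta m (u j) - d].  The sum of the [z_j] is 0, so that the
    congruence also holds for [j = i0].  If [d > 0], then all [z_j] are less than
    [N], hence nonpositive multiples of [N] with sum 0, hence all zero; this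
    contradicts the case where [beta l j = 0].  The case [d < 0] is symmetric.  If
    [d = 0], then [z_j] is less than [N] in absolute value, so that both sequences
    have the same values, and being decreasing they are equal. *)
Lemma beta_congruent l m (d : int) (u : 'S_n) (i0 : 'I_n) :
  \sum_i (beta l i)%:Z - \sum_i (beta m i)%:Z = d * n%:Z ->
  (forall j, j != i0 -> (N%:Z %| (beta l j)%:Z - (beta m (u j))%:Z - d)%Z) ->
  l = m /\ u = 1%g.
Proof.
move=> sum_d dvdz0.
pose z j := (beta l j)%:Z - (beta m (u j))%:Z - d.
have sum_z : \sum_j z j = 0.
  rewrite /z !sumrB sumr_const card_ord.
  have -> : \sum_i (beta m (u i))%:Z = \sum_i (beta m i)%:Z.
    by rewrite [RHS](reindex_inj (@perm_inj _ u)).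
  by rewrite sum_d -mulr_natr natz subrr.
have dvd j : (N%:Z %| z j)%Z.
  case: (eqVneq j i0) => [->|/dvdz0 //].
  have -> : z i0 = - \sum_(i | i != i0) z i.
    by apply/eqP; rewrite -addr_eq0; move/eqP: sum_z; rewrite (bigD1 i0).
  by rewrite rpredN; apply: rpred_sum => i /dvdz0.
have lt_l j := beta_lt l j; have lt_m j := beta_lt m j.
have lt1 : (n.-1 < n)%N by lia.
pose i1 := Ordinal lt1.
have l0 : beta l i1 = 0%N by apply: beta_last; rewrite /= prednK.
have m0 : beta m i1 = 0%N by apply: beta_last; rewrite /= prednK.
have z_all0 : (forall j, 0 <= z j) \/ (forall j, z j <= 0) -> forall j, z j = 0.
  case=> sgn j.
    have /psumr_eq0P -> // : \sum_j z j = 0 by [].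
  apply: oppr_inj; rewrite oppr0.
  have /psumr_eq0P -> // : \sum_j - z j = 0 by rewrite sumrN sum_z oppr0.
  by move=> i _; rewrite oppr_ge0.
(* a multiple of [N] that is less than [N] is nonpositive *)
have small x (q : int) : x = q * N%:Z -> x < N%:Z -> x <= 0.
  by move=> -> lt; rewrite pmulr_lle0 ?ltz_nat // leNgt; apply/negP => q_gt0; nia.
have d0 : d = 0.
  case: (ltgtP d 0) => // d_sgn.
    have z0 : forall j, z j = 0.
      apply: z_all0; left=> j; rewrite -oppr_le0.
      have /dvdzP[q zq] := dvd j.
      apply: (@small _ (- q)); first by rewrite zq mulNr.
      by have := lt_l j; have := lt_m (u j); rewrite /z; lia.
    by have := z0 (u^-1%g i1); rewrite /z permKV m0; lia.
  have z0 : forall j, z j = 0.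
    apply: z_all0; right=> j.
    have /dvdzP[q zq] := dvd j; apply: (small _ _ zq).
    by have := lt_l j; have := lt_m (u j); rewrite /z; lia.
  by have := z0 i1; rewrite /z l0; lia.
have lm j : beta m (u j) = beta l j.
  have /dvdzP[q zq] := dvd j.
  have le0 : z j <= 0 by apply: (small _ _ zq); have := lt_l j; rewrite /z d0; lia.
  have ge0 : - z j <= 0.
    apply: (@small _ (- q)); first by rewrite zq mulNr.
    by have := lt_m (u j); rewrite /z d0; lia.
  by move: le0 ge0; rewrite /z d0; lia.
have u1 := decreasing_perm (@beta_decreasing _ _ m) (@beta_decreasing _ _ l) lm.
by split=> //; apply: beta_weight_inj => j; rewrite -lm u1 perm1.
Qed.

Lemma center_beta l : n%:R * center R (labels l) = (\sum_i beta l i)%N%:R.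
Proof.
apply/eqP; rewrite eq_sym -subr_eq0 -(sum_shifted R n_gt0 (labels l)).
under [X in _ == X]eq_bigr do rewrite shifted_beta.
by rewrite sumrB sumr_const card_ord natr_sum mulr_natl.
Qed.

(** The contribution to the product of the alternants of [l] and [m] at a weight
    [s] of the terms in which the permutation of the first alternant arranges the
    beta-numbers of [s] as [f].  The shift [d] accounts for the center of [s]. *)
Definition overlap l m (d : int) (f : {ffun 'I_n -> 'I_N}) : R[i] :=
  \sum_(u : 'S_n) (-1) ^+ u
    * \prod_j turn N (- ((f j)%:R * ((beta l j)%:Z - (beta m (u j))%:Z - d)%:~R)).

Lemma overlap_det l m d f :
  overlap l m d f = (\prod_j turn N (- ((f j)%:R * ((beta l j)%:Z - d)%:~R)))
     * \det (\matrix_(j, i) turn N ((f j)%:R * (beta m i)%:R : R)).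
Proof.
rewrite /determinant mulr_sumr; apply: eq_bigr => u _; rewrite mulrCA; congr (_ * _).
rewrite -big_split /=; apply: eq_bigr => j _; rewrite mxE -turnD; congr turn.
by rewrite !intrB -!pmulrn; ring.
Qed.

Lemma overlap_noninj l m d (f : {ffun _}) : ~~ injectiveb f -> overlap l m d f = 0.
Proof.
case/injectivePn => i [j ne eqf]; rewrite overlap_det (determinant_alternate ne) ?mulr0 //.
by move=> a; rewrite !mxE eqf.
Qed.

(** Factoring out the center, and a shift by [d] of all the exponents. *)
Lemma numer_turn l s (d : int) :
  numer R k (labels l) (labels s) =
  turn N (center R (labels s) * (\sum_i beta l i)%N%:R - (\sum_j beta s j)%N%:R * d%:~R) *
  \det (\matrix_(i, j) turn N (- ((beta s j)%:R * ((beta l i)%:Z - d)%:~R) : R)).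
Proof.
pose c := center R (labels s).
have -> : turn N (c * (\sum_i beta l i)%N%:R - (\sum_j beta s j)%N%:R * d%:~R)
    = (\prod_i turn N (c * (beta l i)%:R)) * \prod_j turn N (- ((beta s j)%:R * d%:~R)).
  by rewrite turnD !natr_sum mulr_sumr mulr_suml -sumrN !turn_sum.
rewrite -mulrA [X in _ * X]mulrC -det_scale_cols -det_scale_rows.
congr (\det _); apply/matrixP => i j; rewrite !mxE /point shifted_beta -turnMn -!turnD.
by congr turn; rewrite /c !intrB -!pmulrn; ring.
Qed.

Lemma numer_inv_turn m s :
  numer_inv R k (labels m) (labels s) =
  turn N (- (center R (labels s) * (\sum_i beta m i)%N%:R)) *
  \det (\matrix_(i, j) turn N ((beta s i)%:R * (beta m j)%:R : R)).
Proof.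
have -> : turn N (- (center R (labels s) * (\sum_i beta m i)%N%:R))
    = \prod_i turn N (- (center R (labels s) * (beta m i)%:R)).
  by rewrite natr_sum mulr_sumr -sumrN turn_sum.
rewrite -[X in _ * X]det_tr -det_scale_rows.
congr (\det _); apply/matrixP => i j; rewrite !mxE /point shifted_beta -turnN -turnMn -turnD.
by congr turn; ring.
Qed.

(** The factors left out by [numer_turn] and [numer_inv_turn] cancel, because
    the mean of the beta-numbers of [s] is [center s]. *)
Lemma sum_overlap l m s (d : int) :
  \sum_i (beta l i)%:Z - \sum_i (beta m i)%:Z = d * n%:Z ->
  \sum_w overlap l m d (beta_tuple (s, w))
  = numer R k (labels l) (labels s) * numer_inv R k (labels m) (labels s).
Proof.
move=> sum_d; rewrite (numer_turn _ _ d) numer_inv_turn mulrACA -turnD.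
set t := (X in turn N X).
have -> : t = 0.
  have := congr1 (fun z : int => z%:~R : R) sum_d.
  rewrite intrB intrM !intr_sum_nat -!pmulrn /t -(center_beta s).
  move: (center R (labels s)) (\sum_i _)%N (\sum_i _)%N => c M L h.
  transitivity (c * (L%:R - M%:R) - n%:R * c * d%:~R); first by ring.
  by rewrite h; ring.
rewrite turn0 mul1r /determinant mulr_suml; apply: eq_bigr => w _.
rewrite overlap_det -/(\det _) -mulrA mulrCA; congr (_ * _).
  by apply: eq_bigr => j _; rewrite mxE beta_tupleE.
rewrite -det_row_perm; congr (\det _); apply/matrixP => i j; rewrite !mxE.
by rewrite beta_tupleE.
Qed.

(** The sum over the tuples factors; the entry [i] is fixed and each of the
    other ones runs over all residues. *)
Lemma sum_overlap_zero l m (d : int) (u : 'S_n) i :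
  \sum_(f : {ffun 'I_n -> 'I_N} | f i == 0%N :> nat)
     \prod_j turn N (- ((f j)%:R * ((beta l j)%:Z - (beta m (u j))%:Z - d)%:~R) : R)
  = \prod_(j | j != i) (if (N%:Z %| (beta l j)%:Z - (beta m (u j))%:Z - d)%Z then N%:R else 0).
Proof.
pose Q j := [pred x : 'I_N | (j == i) ==> (x == 0%N :> nat)].
pose F j (x : 'I_N) := turn N (- (x%:R * ((beta l j)%:Z - (beta m (u j))%:Z - d)%:~R) : R).
transitivity (\prod_j \sum_(x | Q j x) F j x).
  rewrite bigA_distr_big_dep; apply: eq_bigl => f; apply/idP/familyP => [fi j|/(_ i)].
    by rewrite inE; apply/implyP => /eqP ->.
  by rewrite inE eqxx.
rewrite (bigD1 i) //= (big_pred1 (Ordinal N_gt0)) => [|x]; last first.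
  by rewrite /= eqxx -val_eqE.
rewrite /F mul0r oppr0 turn0 mul1r; apply: eq_bigr => j /negPf ji.
rewrite (eq_bigl xpredT) => [|x]; last by rewrite /= ji.
rewrite -[(_ %| _)%Z]rpredN -sum_turn //; apply: eq_bigr => x _.
by rewrite mulrNz mulrN.
Qed.

Lemma orthogonality_congruent l m (d : int) :
  \sum_i (beta l i)%:Z - \sum_i (beta m i)%:Z = d * n%:Z ->
  \sum_(s : weight n k) numer R k (labels l) (labels s) * numer_inv R k (labels m) (labels s)
  = (l == m)%:R * (n * N ^ (n - 1))%N%:R.
Proof.
move=> sum_d; under eq_bigr do rewrite -(sum_overlap _ sum_d).
rewrite -(sum_beta_tuples n_gt0 (@overlap_noninj l m d)).
have term i (u : 'S_n) : \prod_(j | j != i)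
     (if (N%:Z %| (beta l j)%:Z - (beta m (u j))%:Z - d)%Z then N%:R else 0)
   = ((l == m) && (u == 1%g))%:R * (N ^ (n - 1))%N%:R :> R[i].
  case: (boolP [forall j, (j != i) ==> (N%:Z %| (beta l j)%:Z - (beta m (u j))%:Z - d)%Z]).
    move/forall_inP => dvd; have [lm u1] := beta_congruent sum_d dvd.
    under eq_bigr => j ji do rewrite dvd //.
    by rewrite lm u1 !eqxx mul1r prodr_const natrX cardC1 card_ord subn1.
  move=> ndvd; have /negPf -> : ~~ ((l == m) && (u == 1%g)).
    apply: contra ndvd => /andP[/eqP lm /eqP u1]; apply/forall_inP => j _.
    move: sum_d; rewrite lm u1 perm1 subrr => /esym/eqP; rewrite mulf_eq0.
    by case/orP => /eqP; [move=> ->; rewrite subrr | lia].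
  case/forall_inPn: ndvd => j ji ndvd.
  by rewrite mul0r (bigD1 j) //= (negPf ndvd) mul0r.
under eq_bigr => i _.
  rewrite exchange_big /=.
  under eq_bigr => u _ do rewrite -mulr_sumr sum_overlap_zero term.
  rewrite (bigD1 (1%g : {perm 'I_n})) //= big1 => [|u /negPf ->]; last by rewrite andbF mul0r mulr0.
  rewrite odd_perm1 expr0 mul1r addr0 eqxx andbT.
  over.
by rewrite sumr_const card_ord natrM mulrCA [RHS]mulr_natl.
Qed.

End Orthogonality.

Section Rotation.
Variables (R : realType) (n k : nat).
Hypothesis n_gt0 : (0 < n)%N.
Local Notation N := (k + n)%N.
Local Notation i0 := (Ordinal n_gt0).

Let N_gt0 : (0 < N)%N. Proof. lia. Qed.
Let n_neq0 : n%:R != 0 :> R.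
Proof. by rewrite pnatr_eq0 -lt0n. Qed.
Let N_neq0 : N%:R != 0 :> R.
Proof. by rewrite pnatr_eq0 -lt0n. Qed.

Lemma rotate_weight_subproof (s : weight n k) :
  (\sum_i [ffun i => val s (ordS i)] i == k)%N.
Proof.
apply/eqP; apply: etrans (eqP (valP s)); rewrite [RHS](reindex_inj (@ordS_inj n)).
by apply: eq_bigr => i _; rewrite ffunE.
Qed.

(** The cyclic symmetry of the affine Dynkin diagram. *)
Definition rotate_weight (s : weight n k) : weight n k :=
  @exist _ (fun m : {ffun 'I_n -> 'I_k.+1} => \sum_i m i == k)%N _ (rotate_weight_subproof s).

Lemma labels_rotate s i : labels (rotate_weight s) i = labels s (ordS i).
Proof. by rewrite /labels /= ffunE. Qed.

Lemma rotate_weight_inj : injective rotate_weight.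
Proof.
move=> s t E; apply/val_inj/ffunP => i; apply: val_inj.
by have := labels_rotate s (ord_pred i); rewrite E labels_rotate ord_predK.
Qed.

(** Rotating the labels permutes the beta-numbers cyclically modulo [N], up to a
    common shift: when the last value 0 becomes negative, [N] is added to it. *)
Lemma beta_rotate s i :
  (beta (labels (rotate_weight s)) i + (if i.+1 == n then N else 0)
   = beta (labels s) (ordS i) + (labels s i0).+1)%N.
Proof.
have lvl := part_level s (erefl : i0 = 0%N :> nat).
case: eqP => [i_last|i_nlast].
  rewrite beta_last // add0n (_ : ordS i = i0); last by apply: val_inj; rewrite /= i_last modnn.
  by rewrite /beta /=; lia.
have lt_in : (i.+1 < n)%N by have := ltn_ord i; lia.
have oi : ordS i = i.+1 :> nat by rewrite /= modn_small.
rewrite addn0 /beta oi.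
suff -> : (part (labels (rotate_weight s)) i = part (labels s) (ordS i) + labels s i0)%N by lia.
rewrite /part (reindex_inj (@ord_pred_inj n)) (bigD1 i0) /=; last first.
  by rewrite add0n modn_small; lia.
rewrite labels_rotate ord_predK addnC; congr (_ + _)%N; apply: eq_big => j.
  rewrite -val_eqE /= (modn_small lt_in); have := ltn_ord j; case: (posnP j) => [->|j_gt0] lt.
    by rewrite andbF.
  rewrite (_ : (j + n).-1 %% n = j.-1)%N; first by lia.
  by rewrite -subn1 addnC -addnBA // modnDl modn_small; lia.
by rewrite labels_rotate ord_predK.
Qed.

Lemma center_rotate s :
  center R (labels (rotate_weight s))
  = center R (labels s) + (labels s i0).+1%:R - N%:R / n%:R.
Proof.
have lt1 : (n.-1 < n)%N by lia.
have sum_last : (\sum_(i < n) (if i.+1 == n then N else 0) = N)%N.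
  by rewrite -big_mkcond (big_pred1 (Ordinal lt1)) // => i /=; rewrite -val_eqE /=; lia.
have sumE : (\sum_i beta (labels (rotate_weight s)) i + N
    = \sum_i beta (labels s) i + n * (labels s i0).+1)%N.
  rewrite -[X in (_ + X)%N = _]sum_last -big_split /=.
  rewrite (eq_bigr _ (fun i _ => beta_rotate s i)) big_split /=.
  by rewrite sum_nat_const card_ord [in RHS](reindex_inj (@ordS_inj n)).
apply: (mulfI n_neq0); rewrite center_beta // mulrBr mulrDr center_beta //.
have := congr1 (fun a => a%:R : R) sumE; rewrite !natrD natrM => h.
apply: (addIr (k%:R + n%:R)); rewrite h mulrCA divff // mulr1; ring.
Qed.

Definition rotation_factor : R[i] := turn n (- 1).

(** The common shift in [beta_rotate] only contributes through its difference
    with the shift of the mean, which is [N / n]. *)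
Lemma point_rotate s i :
  point R k (labels (rotate_weight s)) i = rotation_factor * point R k (labels s) (ordS i).
Proof.
have -> : rotation_factor = turn N (- (N%:R / n%:R)).
  by rewrite /rotation_factor /turn; congr expi; field; rewrite n_neq0 -natrD N_neq0.
rewrite /point -turnD !shifted_beta center_rotate.
have := congr1 (fun a => a%:R : R) (beta_rotate s i); rewrite natrD [in RHS]natrD => h.
have -> : (beta (labels (rotate_weight s)) i)%:R = (beta (labels s) (ordS i))%:R
   + (labels s i0).+1%:R - (if i.+1 == n then N else 0)%:R :> R by rewrite -h addrK.
transitivity (turn N ((if i.+1 == n then 1 else 0) * N%:R) * 
   turn N (- (N%:R / n%:R) - ((beta (labels s) (ordS i))%:R - center R (labels s))) : R[i]).
  rewrite -turnD; congr turn; case: ifP => _; ring.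
by case: ifP => _; rewrite ?mul1r ?mul0r ?turn0 ?turn_full ?mul1r.
Qed.

(** A cyclic permutation of the variables changes the alternant by a sign
    only, and this sign occurs twice in the product of two alternants. *)
Lemma alternant_rotate (l : 'I_n -> nat) (c : R[i]) (x : 'I_n -> R[i]) :
  \det (alternant l (fun j => c * x (ordS j)))
  = (-1) ^+ perm (@ordS_inj n) * c ^+ (\sum_i l i)%N * \det (alternant l x).
Proof.
rewrite -prodrXr -mulrA -det_scale_rows -det_col_perm.
by congr (\det _); apply/matrixP => i j; rewrite !mxE permE exprMn.
Qed.

(** Rotation permutes the weights and multiplies each term by the same root of
    unity, which is not 1. *)
Lemma sum_numer_incongruent (l m : weight n k) :
  ~~ (n%:Z %| \sum_i (beta (labels l) i)%:Z - \sum_i (beta (labels m) i)%:Z)%Z ->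
  \sum_(s : weight n k) numer R k (labels l) (labels s) * numer_inv R k (labels m) (labels s)
  = 0.
Proof.
move=> ndvd; set S := \sum_s _.
pose q := rotation_factor ^+ (\sum_i beta (labels l) i)
          * rotation_factor^-1 ^+ (\sum_i beta (labels m) i).
have Sq : S = q * S.
  rewrite {1}/S (reindex_inj rotate_weight_inj) mulr_sumr; apply: eq_bigr => s _.
  have -> : numer R k (labels l) (labels (rotate_weight s))
    = (-1) ^+ perm (@ordS_inj n) * rotation_factor ^+ (\sum_i beta (labels l) i)
      * numer R k (labels l) (labels s).
    rewrite -alternant_rotate; congr (\det _); apply/matrixP => i j.
    by rewrite !mxE point_rotate.
  have -> : numer_inv R k (labels m) (labels (rotate_weight s))
    = (-1) ^+ perm (@ordS_inj n) * rotation_factor^-1 ^+ (\sum_i beta (labels m) i)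
      * numer_inv R k (labels m) (labels s).
    rewrite -alternant_rotate; congr (\det _); apply/matrixP => i j.
    by rewrite !mxE point_rotate invfM.
  by rewrite mulrACA; congr (_ * _); rewrite mulrACA -expr2 sqrr_sign mul1r.
have [//|S0] := eqVneq S 0; case/negP: ndvd.
have q1 : q = 1 by apply: (mulIf S0); rewrite mul1r -Sq.
rewrite -rpredN -(turn_eq1 R n_gt0) -q1 /q /rotation_factor -turnN -!turnMn -turnD.
by apply/eqP; congr turn; rewrite !mulN1r opprK mul1r mulrNz intrB !intr_sum_nat opprB addrC.
Qed.

Lemma sum_numer (l m : weight n k) :
  \sum_(s : weight n k) numer R k (labels l) (labels s) * numer_inv R k (labels m) (labels s)
  = (l == m)%:R * (n * N ^ (n - 1))%N%:R.
Proof.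
case: (boolP (n%:Z %| \sum_i (beta (labels l) i)%:Z - \sum_i (beta (labels m) i)%:Z)%Z).
  by case/dvdzP => d; apply: orthogonality_congruent.
move=> ndvd; rewrite sum_numer_incongruent //; case: eqP ndvd => [->|]; last by rewrite mul0r.
by rewrite subrr dvdz0.
Qed.

Lemma Smatrix_orthogonal (l m : weight n k) :
  \sum_(s : weight n k) Smatrix R k (labels l) (labels s) * Smatrix R k (dual (labels m)) (labels s)
  = (l == m)%:R.
Proof.
transitivity (\sum_(s : weight n k) prefactor R n k ^+ 2 * (-1) ^+ 'C(n, 2)
    * (numer R k (labels l) (labels s) * numer_inv R k (labels m) (labels s))).
  by apply: eq_bigr => s _; rewrite Smatrix_numer // Smatrix_dual //; ring.
rewrite -mulr_sumr sum_numer prefactor_sqr.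
rewrite mulrCA mulVf ?mulr1 // pnatr_eq0 muln_eq0 expn_eq0; lia.
Qed.

End Rotation.

(** * Points of the quotient ring *)

Section SymEval.
Variables (F : fieldType) (k : nat) (y : 'I_k -> F).

Definition sym_eval (a : sympoly k) : F := mmap intr y (val a).

Lemma sym_eval_zmod : zmod_morphism sym_eval.
Proof. by move=> a b; rewrite /sym_eval !raddfB. Qed.

HB.instance Definition _ := GRing.isZmodMorphism.Build (sympoly k) F sym_eval sym_eval_zmod.

Lemma sym_eval_monoid : monoid_morphism sym_eval.
Proof. by split=> [|a b]; rewrite /sym_eval ?rmorph1 ?rmorphM. Qed.

HB.instance Definition _ := GRing.isMonoidMorphism.Build (sympoly k) F sym_eval sym_eval_monoid.

Lemma sym_eval_schur (mu : 'I_k -> nat) :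
  sym_eval (schur mu) * \det (alternant (fun i => k - i.+1)%N y)
  = \det (alternant (fun i => mu i + (k - i.+1))%N y).
Proof.
have detE (e : 'I_k -> nat) :
    mmap intr y (\det (alternant e (fun j => 'X_j))) = \det (alternant e y) :> F.
  rewrite -det_map_mx; congr (\det _); apply/matrixP => i j; rewrite !mxE.
  by rewrite rmorphXn /= mmapX mmap1U.
by rewrite -!detE -schur_alternant rmorphM.
Qed.

Lemma sym_eval_e_top : sym_eval (sym_e k k) = \prod_i y i.
Proof.
rewrite /sym_eval /= mesymnnE rmorph_prod; apply: eq_bigr => i _.
by rewrite /= mmapX mmap1U.
Qed.

End SymEval.

Section Relations.
Variables (F : fieldType) (n k' : nat) (y : 'I_k'.+1 -> F) (c : F).
Local Notation k := k'.+1.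
Hypotheses (y_inj : injective y) (yN : forall j, y j ^+ (n + k) = c).
Hypotheses (c_neq0 : c != 0) (prod_y : (-1) ^+ k' * \prod_j y j = c).
Local Notation ev := (sym_eval y).
Local Notation delta := (fun i : 'I_k => k - i.+1)%N.

Definition row_exp r (i : 'I_k) : nat := if i == ord0 then r else 0%N.

(** [h_r] is the Schur polynomial of a single row. *)
Lemma sym_eval_h r : ev (sym_h k r) * \det (alternant delta y)
  = \det (alternant (fun i => row_exp r i + (k - i.+1))%N y).
Proof.
rewrite -sym_eval_schur; congr (_ * _).
rewrite schur_uptrig => [|i i_gt0]; last by rewrite /row_exp -val_eqE /= gtn_eqF.
rewrite big_ord_recl big1 ?mulr1 // => i _.
by rewrite /row_exp sym_h0.
Qed.

(** As [y ^ N = c], the first row of the alternant is proportional to a later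
    one. *)
Lemma sym_eval_h_vanish i : (0 < i < k)%N -> ev (sym_h k (n + i)) = 0.
Proof.
case/andP=> i_gt0 lt_ik; apply: (mulIf (alternant_neq0 y_inj)); rewrite mul0r sym_eval_h.
have lt : (k - i < k)%N by lia.
pose A : 'M[F]_k := alternant (fun a => if a == ord0 then i.-1 else k - a.+1)%N y.
have -> : alternant (fun a => row_exp (n + i) a + (k - a.+1))%N y
     = \matrix_(a, b) ((if a == ord0 then c else 1) * A a b).
  apply/matrixP => a b; rewrite !mxE /row_exp; case: eqP => [->|_]; last by rewrite mul1r.
  by rewrite -(yN b) -exprD; congr (_ ^+ _) => /=; lia.
rewrite det_scale_rows (@determinant_alternate _ _ A ord0 (Ordinal lt)) ?mulr0 //.
  by rewrite -val_eqE /=; lia.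
move=> b; rewrite !mxE eqxx ifN; last by rewrite -val_eqE /=; lia.
by congr (_ ^+ _) => /=; lia.
Qed.

Lemma sym_eval_h_top : ev (sym_h k (n + k)) = c.
Proof.
apply: (mulIf (alternant_neq0 y_inj)); rewrite sym_eval_h.
have -> : alternant (fun a => row_exp (n + k) a + (k - a.+1))%N y
     = \matrix_(a, b) ((if a == ord0 then c else 1) * alternant delta y a b).
  apply/matrixP => a b; rewrite !mxE /row_exp; case: eqP => [->|_]; last by rewrite mul1r.
  by rewrite -(yN b) -exprD.
by rewrite det_scale_rows big_ord_recl big1 ?mulr1.
Qed.

(** Multiplying each column by its [y j] turns the exponents [(N - 1, k - 2, ..., 0)]
    into [(N, k - 1, ..., 1)]; as [y ^ N = c], this is a cyclic permutation of the
    usual exponents, up to the factor [c]. *)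
Lemma sym_eval_h_n : ev (sym_h k n) = 1.
Proof.
have py0 : \prod_j y j != 0.
  by apply: contraNneq c_neq0 => p0; rewrite -prod_y p0 mulr0.
apply: (mulIf (mulf_neq0 (alternant_neq0 y_inj) py0)); rewrite mulrA sym_eval_h mul1r.
rewrite -det_scale_cols.
(* [s] sends row 0 to the last row, of exponent 0, and row [i] to row [i - 1] *)
pose s : 'S_k := lift_perm ord0 ord_max 1%g.
have -> : \matrix_(i, j) (alternant (fun a => row_exp n a + (k - a.+1))%N y i j * y j)
   = \matrix_(a, b) ((if a == ord0 then c else 1) * row_perm s (alternant delta y) a b).
  apply/matrixP => a b; rewrite !mxE /row_exp -exprSr.
  case: (unliftP ord0 a) => [a'|] -> {a}.
    rewrite /s lift_perm_lift perm1 lift_max mul1r /=; congr (_ ^+ _).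
    by have := ltn_ord a'; rewrite /= /bump leq0n; lia.
  rewrite eqxx /s lift_perm_id -(yN b) -exprD; congr (_ ^+ _) => /=; lia.
rewrite det_scale_rows big_ord_recl big1 // mulr1 det_row_perm mulrA.
rewrite mulrC; congr (_ * _); rewrite -prod_y odd_lift_perm odd_perm1 addbF /=.
by rewrite signr_odd mulrAC -expr2 sqrr_sign mul1r.
Qed.

Lemma sym_eval_fusion_rels x : x \in ideal_gen (fusion_rels n k) -> ev x = 0.
Proof.
apply: (rmorph_ideal_gen (phi := sym_eval y)) => {x} x.
rewrite inE mem_cat !inE => /or3P[/eqP ->|/mapP[j] |/eqP ->].
- by rewrite rmorphB rmorph1 /= sym_eval_h_n subrr.
- by rewrite mem_iota => j_bnd ->; apply: sym_eval_h_vanish; lia.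
rewrite rmorphD rmorphM rmorphXn rmorphN1 /= sym_eval_h_top sym_eval_e_top -prod_y.
by rewrite exprS mulN1r mulNr subrr.
Qed.

End Relations.

(** * Complementary roots and complementary minors *)

Section Edges.
Variables (n k : nat).
Local Notation N := (k + n)%N.
Implicit Types l s : weight n k.

Local Notation lam l := (part (labels l)).
Local Notation mu l := (@transpose_part n k (part (labels l))).

(** The positions of the [k] vertical and of the [n] horizontal steps on the
    boundary path of the Young diagram of the transpose of [part l].  Together they
    exhaust [0, ..., N - 1]. *)
Definition edge l (q : 'I_N) : nat :=
  match split q with
  | inl i => (mu l i + (k - i.+1))%N
  | inr j => (N - (beta (labels l) j).+1)%N
  end.

Lemma edge_lshift l i : edge l (lshift n i) = (mu l i + (k - i.+1))%N.
Proof. by rewrite /edge (unsplitK (inl i)). Qed.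

Lemma edge_rshift l j : edge l (rshift k j) = (N - (beta (labels l) j).+1)%N.
Proof. by rewrite /edge (unsplitK (inr j)). Qed.

Lemma edge_lt l q : (edge l q < N)%N.
Proof.
case: (split_ordP q) => [i|j] ->; rewrite ?edge_lshift ?edge_rshift.
  have : (mu l i <= n)%N by rewrite -[leqRHS]card_ord max_card.
  by have := ltn_ord i; lia.
by have := beta_lt l j; lia.
Qed.

(** A horizontal step precedes a vertical one exactly when they bound a hook,
    i.e. when the box in this row and column is in the diagram. *)
Lemma edge_crossing l i j :
  (edge l (rshift k j) < edge l (lshift n i))%N = (i < lam l j)%N
  /\ edge l (rshift k j) != edge l (lshift n i).
Proof.
rewrite edge_lshift edge_rshift.
have := ltn_transpose_part i j (fun a b => @part_noninc _ (labels l) a b).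
have := beta_lt l j; rewrite /beta; have := ltn_ord i; have := ltn_ord j.
by have := part_le_level l j; case: (ltnP i (lam l j)); lia.
Qed.

Lemma edge_inj l : injective (fun q => Ordinal (edge_lt l q)).
Proof.
have mu_dec (i j : 'I_k) : (i < j)%N -> (edge l (lshift n j) < edge l (lshift n i))%N.
  move=> lt; rewrite !edge_lshift.
  have : (mu l j <= mu l i)%N by apply: transpose_noninc; apply: ltnW.
  by have := ltn_ord i; have := ltn_ord j; lia.
move=> q q' [].
case: (split_ordP q) => [i|i] ->; case: (split_ordP q') => [j|j] -> E.
- by congr (lshift n _); apply: val_inj; case: (ltngtP i j) => // /mu_dec; rewrite E ltnn.
- by have [_ /eqP] := edge_crossing l i j; rewrite E.
- by have [_ /eqP] := edge_crossing l j i; rewrite E.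
congr (rshift k _); apply: (@beta_ord_inj _ _ l); move: E; rewrite !edge_rshift.
by have := beta_lt l i; have := beta_lt l j; lia.
Qed.

Definition edge_perm l : 'S_N := perm (@edge_inj l).

Lemma edge_permE l q : edge_perm l q = edge l q :> nat.
Proof. by rewrite permE. Qed.

(** All pairs of vertical steps are inverted, no pair of horizontal steps is,
    and the mixed inversions are the boxes of the diagram. *)
Lemma odd_edge_perm l : odd_perm (edge_perm l)
  = odd (\sum_(i < k) \sum_(j < k | (i < j)%N) 1 + \sum_j lam l j).
Proof.
rewrite odd_perm_inversions; congr odd.
rewrite big_split_ord /= [X in (_ + X)%N]big1 ?addn0 => [|i _]; last first.
  rewrite big_split_ord /= big1 ?add0n => [|j lt]; last by have := ltn_ord j; lia.
  rewrite big1 // => j; rewrite ltn_add2l => lt; rewrite !edge_permE !edge_rshift.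
  by have := beta_decr l lt; have := beta_lt l j; have := beta_lt l i; lia.
under eq_bigr => i _ do rewrite big_split_ord /=.
rewrite big_split /=; congr (_ + _)%N.
  apply: eq_bigr => i _; apply: eq_bigr => j lt; rewrite !edge_permE !edge_lshift.
  have : (mu l j <= mu l i)%N by apply: transpose_noninc; apply: ltnW.
  by have := ltn_ord i; have := ltn_ord j; lia.
transitivity (\sum_(i < k) \sum_(j < n) (i < lam l j))%N.
  apply: eq_bigr => i _; apply: eq_big => [j|j _]; first by have := ltn_ord i; lia.
  by rewrite !edge_permE (edge_crossing l i j).1.
rewrite exchange_big /=; apply: eq_bigr => j _.
by rewrite -[RHS](card_ord_lt (part_le_level l j)) -sum1dep_card [RHS]big_mkcond.
Qed.

Variable R : realType.
Hypothesis n_gt0 : (0 < n)%N.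

Let N_gt0 : (0 < N)%N. Proof. lia. Qed.
Let N_neq0 : N%:R != 0 :> R[i]. Proof. by rewrite pnatr_eq0 -lt0n. Qed.

Definition twist s : R[i] := - turn N (center R (labels s) - N.-1%:R).
(** The [N] roots of [z ^ N = twist s ^ N], numbered so that the last [n] of them are
    the opposites of the [point s j]. *)
Definition zpoint s (q : 'I_N) : R[i] := twist s * turn N (edge s q)%:R.

Lemma twist_neq0 s : twist s != 0.
Proof. by rewrite oppr_eq0 turn_neq0. Qed.

Lemma zpoint_neq0 s q : zpoint s q != 0.
Proof. by rewrite mulf_neq0 ?twist_neq0 ?turn_neq0. Qed.

Lemma zpoint_rshift s j : zpoint s (rshift k j) = - point R k (labels s) j.
Proof.
rewrite /zpoint /twist mulNr -turnD edge_rshift /point shifted_beta.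
have lt := beta_lt s j; congr (- turn _ _).
by rewrite -subn1 (natrB _ lt) (natrB _ N_gt0) -natr1; ring.
Qed.

Lemma zpoint_inj s : injective (zpoint s).
Proof.
move=> q q' /(mulfI (twist_neq0 s)) /turn_nat_inj E.
by apply: (@edge_inj s); apply: val_inj; apply: E; apply: edge_lt.
Qed.

Lemma zpointXN s q : zpoint s q ^+ N = twist s ^+ N.
Proof. by rewrite exprMn -turnMn -[(edge s q)%:R]/((edge s q)%:Z%:~R) turn_int // mulr1. Qed.

(** The positions [edge s q] are all the residues, with sum [N (N - 1) / 2]. *)
Lemma prod_zpoint s : \prod_q zpoint s q = twist s ^+ N * (-1) ^+ N.-1.
Proof.
rewrite big_split /= prodr_const card_ord; congr (_ * _).
rewrite -turn_sum -natr_sum.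
have -> : (\sum_q edge s q = 'C(N, 2))%N.
  under eq_bigr do rewrite -edge_permE.
  by rewrite -bin2_sum big_mkord [RHS](reindex_inj (@perm_inj _ (edge_perm s))).
rewrite -expi_pi -expiMn /turn; congr expi.
apply: (mulIf (_ : 2 != 0)); first by rewrite pnatr_eq0.
rewrite -[LHS]mulrA -natrM double_bin2 natrM -subn1; field.
by rewrite -natrD pnatr_eq0 -lt0n.
Qed.

(** The point of the quotient ring that corresponds to the weight [s]. *)
Definition ypoint s (i : 'I_k) := zpoint s (lshift n i).

Lemma ypoint_inj s : injective (ypoint s).
Proof. by move=> i j /zpoint_inj/lshift_inj. Qed.

Lemma prod_ypoint s : (0 < k)%N -> (-1) ^+ k.-1 * \prod_i ypoint s i = twist s ^+ N.
Proof.
move=> k_gt0; have := prod_zpoint s; rewrite big_split_ord /=.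
under [X in _ * X]eq_bigr do rewrite zpoint_rshift.
rewrite prodrN cardT size_enum_ord prod_point // mulr1 => E.
have -> : \prod_i ypoint s i = twist s ^+ N * (-1) ^+ N.-1 * (-1) ^+ n.
  by rewrite -E -mulrA -exprMn mulrNN mulr1 expr1n mulr1.
rewrite mulrC -!mulrA -!exprD (_ : (N.-1 + (n + k.-1) = 2 * N.-1)%N); last by lia.
by rewrite exprM sqrrN expr1n expr1n mulr1.
Qed.

(** The orthogonality of the characters of the group of [N]-th roots of unity. *)
Lemma zpoint_duality l s :
  alternant (edge l) (zpoint s)
  *m (\matrix_(i, j) (N%:R^-1 * (zpoint s i)^-1 ^+ edge l j)) = 1%:M.
Proof.
apply/matrixP => a b; rewrite !mxE.
transitivity (twist s ^+ edge l a * (twist s)^-1 ^+ edge l b * N%:R^-1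
    * \sum_(x < N) turn N (x%:R * ((edge l a)%:Z - (edge l b)%:Z)%:~R : R)).
  rewrite [X in _ = _ * X](reindex_inj (@perm_inj _ (edge_perm s))) mulr_sumr.
  apply: eq_bigr => q _.
  rewrite edge_permE !mxE /zpoint invfM !exprMn -turnN -!turnMn.
  rewrite intrB -!pmulrn mulrBr -mulNr turnD; ring.
rewrite sum_turn // dvdz_ltn_eq ?edge_lt //.
have -> : (edge l a == edge l b) = (a == b).
  by rewrite -!edge_permE val_eqE (inj_eq (@perm_inj _ _)).
case: eqP => [->|_]; last by rewrite mulr0.
by rewrite mulfVK // -exprMn divff ?twist_neq0 ?expr1n.
Qed.

(** By [det_minor_mulmx1] applied to [zpoint_duality], the left side is a minor
    with rows [edge l], and the complementary minor of the inverse is an alternant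
    in the opposites of the points.  The sign of [edge_perm l] and the sign coming
    from these opposites both are [(-1) ^ |lambda|] up to a factor independent of
    [l]. *)
Lemma alternant_ypoint s : exists K : R[i], forall l,
  \det (alternant (fun i => mu l i + (k - i.+1))%N (ypoint s))
  = K * numer R k (labels l) (labels s).
Proof.
pose D := \det (alternant (fun q : 'I_N => q : nat) (zpoint s)).
pose C0 := (\sum_(i < k) \sum_(j < k | (i < j)%N) 1)%N.
pose E := \prod_(i < n) (N%:R^-1 * (zpoint s (rshift k i))^-1 ^+ N.-1).
exists ((-1) ^+ (C0 + \sum_(i < n) (n - i.+1)) * D * E) => l.
have := det_minor_mulmx1 (zpoint_duality l s).
have -> : ulsubmx (alternant (edge l) (zpoint s))
    = alternant (fun i => mu l i + (k - i.+1))%N (ypoint s).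
  by apply/matrixP => i j; rewrite !mxE edge_lshift.
have -> : alternant (edge l) (zpoint s)
    = row_perm (edge_perm l) (alternant (fun q : 'I_N => q : nat) (zpoint s)).
  by apply/matrixP => i j; rewrite !mxE edge_permE.
rewrite det_row_perm -/D => ->.
have -> : \det (drsubmx (\matrix_(i, j) (N%:R^-1 * (zpoint s i)^-1 ^+ edge l j)))
    = E * ((-1) ^+ (\sum_i beta (labels l) i) * numer R k (labels l) (labels s)).
  pose X := alternant (beta (labels l)) (point R k (labels s)).
  have -> : drsubmx (\matrix_(i, j) (N%:R^-1 * (zpoint s i)^-1 ^+ edge l j))
      = \matrix_(i, j) (N%:R^-1 * (zpoint s (rshift k i))^-1 ^+ N.-1
          * (\matrix_(i, j) (X^T i j * (-1) ^+ beta (labels l) j)) i j).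
    apply/matrixP => i j; rewrite !mxE edge_rshift -mulrA; congr (_ * _).
    have lt := beta_lt l j; set b := beta (labels l) j in lt *.
    have z0 := zpoint_neq0 s (rshift k i).
    rewrite -exprMn mulrN1 -zpoint_rshift.
    have -> : N.-1 = (N - b.+1 + b)%N by lia.
    by rewrite exprD -mulrA -exprMn mulVf // expr1n mulr1.
  by rewrite det_scale_rows det_scale_cols det_tr -prodrXr [_ * \prod_j _]mulrC.
rewrite odd_edge_perm signr_odd -/C0.
rewrite /beta big_split /= !exprD.
set a := (-1) ^+ C0; set b := (-1) ^+ _; set c := (-1) ^+ (\sum_i (n - _))%N.
have bb : b * b = 1 by rewrite -expr2 sqrr_sign.
move: (numer _ _ _ _) => T; rewrite -[RHS]mulr1 -[X in _ = _ * X]bb.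
ring.
Qed.

End Edges.

(** * Verlinde sums as structure constants *)

Section Verlinde.
Variables (R : realType) (n k' : nat).
Hypothesis n_gt0 : (0 < n)%N.
Local Notation k := k'.+1.
Local Notation N := (k + n)%N.
Local Notation pi := (quotring_proj (fusion_rels n k)).
Local Notation smap := (@schur_map n k).
Local Notation tpart l := (@transpose_part n k (part (labels l))).
Local Notation numer l s := (numer R k l (labels s)).
Implicit Types l m s v : weight n k.

Lemma vacuum_weight : exists v, labels v =1 vacuum k.
Proof.
apply: weight_of_labels; rewrite (bigD1 (Ordinal n_gt0)) //= big1 ?addn0 // => i.
by rewrite /vacuum -val_eqE /= => /negPf ->.
Qed.

Lemma part_vacuum (i : 'I_n) : part (vacuum k) i = 0%N :> nat.
Proof. by rewrite /part big1 // => j; rewrite /vacuum; case: eqP => // ->. Qed.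

Lemma part_eq (f g : 'I_n -> nat) : f =1 g -> part f =1 part g.
Proof. by move=> fg i; apply: eq_bigr => j _; apply: fg. Qed.

Lemma numer_vacuumE v s : labels v =1 vacuum k -> numer (labels v) s = numer (vacuum k) s.
Proof.
move=> vE; congr (\det _); apply/matrixP => i j.
by rewrite !mxE /beta (part_eq vE).
Qed.

Lemma numer_vacuum_neq0 s : numer (vacuum k) s != 0.
Proof.
have -> : numer (vacuum k) s = \det (alternant (fun i => n - i.+1)%N (point R k (labels s))).
  congr (\det _); apply/matrixP => i j.
  by rewrite !mxE /beta part_vacuum.
by apply: alternant_neq0; apply: point_inj.
Qed.

Lemma prefactor_neq0 : prefactor R n k != 0.
Proof.
apply/eqP => p0; have := prefactor_sqr R n k; rewrite p0 expr0n mul0r.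
by move/esym/eqP; rewrite invr_eq0 pnatr_eq0 muln_eq0 expn_eq0; lia.
Qed.

Lemma transpose_vacuum v i : labels v =1 vacuum k -> tpart v i = 0%N.
Proof.
move=> vE; apply/eqP; rewrite cards_eq0; apply/eqP/setP => a.
by rewrite !inE (part_eq vE) part_vacuum.
Qed.

Lemma sym_eval_schur_weight l s :
  sym_eval (ypoint R s) (schur (tpart l)) * numer (vacuum k) s = numer (labels l) s.
Proof.
have [K KE] := alternant_ypoint R n_gt0 s.
have [v vE] := vacuum_weight.
have DE : \det (alternant (fun i : 'I_k => k - i.+1)%N (ypoint R s)) = K * numer (vacuum k) s.
  rewrite -(numer_vacuumE _ vE) -KE; congr (\det _); apply/matrixP => i j.
  by rewrite !mxE transpose_vacuum.
have K_neq0 : K != 0.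
  have y_inj : injective (ypoint R s) by apply: ypoint_inj.
  by have := alternant_neq0 y_inj; rewrite DE mulf_eq0 negb_or => /andP[].
by have := sym_eval_schur (ypoint R s) (tpart l); rewrite KE DE mulrCA; apply: mulfI.
Qed.

Lemma sym_eval_quot s x : pi x = 0 -> sym_eval (ypoint R s) x = 0.
Proof.
move=> x0; apply: (@sym_eval_fusion_rels _ n k' (ypoint R s) (twist R s ^+ N)).
- exact: ypoint_inj.
- by move=> j; rewrite addnC; apply: zpointXN.
- by rewrite expf_neq0 ?twist_neq0.
- exact: prod_ypoint.
by rewrite -[x]subr0; apply/quotring_projP; rewrite x0 raddf0.
Qed.

Lemma schur_map_numer (a : fusion n k) x : smap a = pi x ->
  forall s, sym_eval (ypoint R s) x * numer (vacuum k) s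
    = \sum_(l : weight n k) (a l)%:~R * numer (labels l) s.
Proof.
move=> ax s; pose y := \sum_(l : weight n k) schur (tpart l) *~ a l.
have : pi (x - y) = 0.
  rewrite rmorphB /= -ax rmorph_sum /=; apply/eqP; rewrite subr_eq0; apply/eqP.
  by apply: eq_bigr => l _; rewrite raddfMz.
move=> /(sym_eval_quot s)/eqP; rewrite rmorphB subr_eq0 => /eqP ->.
rewrite rmorph_sum mulr_suml; apply: eq_bigr => l _.
by rewrite raddfMz /= -mulrzl -mulrA sym_eval_schur_weight.
Qed.

Lemma sum_Smatrix (a : fusion n k) v :
  \sum_(s : weight n k) (\sum_(l : weight n k) (a l)%:~R * Smatrix R k (labels l) (labels s))
     * Smatrix R k (dual (labels v)) (labels s) = (a v)%:~R.
Proof.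
under eq_bigr => s _ do rewrite mulr_suml.
rewrite exchange_big (bigD1 v) //= [X in _ + X]big1 ?addr0 => [|l ne].
  under eq_bigr => s _ do rewrite -mulrA.
  by rewrite -mulr_sumr Smatrix_orthogonal // eqxx mulr1.
under eq_bigr => s _ do rewrite -mulrA.
by rewrite -mulr_sumr Smatrix_orthogonal // (negPf ne) mulr0.
Qed.

(** By the values at the points, [S_(l, s) S_(m, s) / S_(0, s)] is the
    combination of the [S_(v, s)] with coefficients [a v], and orthogonality
    extracts the coefficient of [v]. *)
Lemma verlinde_structure_constant l m v (a : fusion n k) :
  smap a = pi (schur (tpart l) * schur (tpart m)) ->
  verlinde R l m v = (a v)%:~R.
Proof.
move=> aE; rewrite -sum_Smatrix; apply: eq_bigr => s _.
rewrite mulrAC; congr (_ * _); rewrite !Smatrix_numer //.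
under eq_bigr => i _ do rewrite Smatrix_numer // mulrCA.
rewrite -mulr_sumr -(schur_map_numer aE) rmorphM /=.
rewrite -!sym_eval_schur_weight.
move: (prefactor _ _ _) (numer (vacuum k) s) prefactor_neq0 (numer_vacuum_neq0 s) => p t p0 t0.
by move: (sym_eval _ _) (sym_eval _ _) => x y; field; rewrite t0 p0.
Qed.

Lemma floor_Re_int (z : int) : Num.floor (complex.Re (z%:~R : R[i])) = z.
Proof. by rewrite -(rmorph_int (real_complex R)) /= intrKfloor. Qed.

Lemma fusion_coef_structure_constant l m (a : fusion n k) :
  smap a = pi (schur (tpart l) * schur (tpart m)) -> a =1 fusion_coef R l m.
Proof.
by move=> aE v; rewrite /fusion_coef (verlinde_structure_constant v aE) floor_Re_int.
Qed.

Lemma fusion_coef_verlinde l m v : (fusion_coef R l m v)%:~R = verlinde R l m v.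
Proof.
have [a aE] := schur_map_surj n_gt0 (pi (schur (tpart l) * schur (tpart m))).
by rewrite (verlinde_structure_constant v aE) -(fusion_coef_structure_constant aE).
Qed.

Lemma schur_product l m : pi (schur (tpart l)) * pi (schur (tpart m))
  = \sum_(v : weight n k) pi (schur (tpart v)) *~ fusion_coef R l m v.
Proof.
have [a aE] := schur_map_surj n_gt0 (pi (schur (tpart l) * schur (tpart m))).
transitivity (smap a); first by rewrite aE rmorphM.
by apply: eq_bigr => v _; rewrite (fusion_coef_structure_constant aE).
Qed.

Lemma schur_mapM a b : smap (fusion_mul R a b) = smap a * smap b.
Proof.
rewrite /schur_map mulr_suml.
under [RHS]eq_bigr => l _ do rewrite mulr_sumr.
transitivity (\sum_(l : weight n k) \sum_(m : weight n k) \sum_(v : weight n k)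
    pi (schur (tpart v)) *~ (a l * b m * fusion_coef R l m v)).
  under [RHS]eq_bigr => l _ do rewrite exchange_big /=.
  rewrite [RHS]exchange_big /=; apply: eq_bigr => v _; rewrite ffunE.
  rewrite (raddf_sum (intmul (pi (schur (tpart v))))) /=; apply: eq_bigr => l _.
  by rewrite (raddf_sum (intmul (pi (schur (tpart v))))).
apply: eq_bigr => l _; apply: eq_bigr => m _.
rewrite mulrzAl mulrzAr schur_product -mulrzA mulrz_suml; apply: eq_bigr => v _.
by rewrite -mulrzA; congr (_ *~ _); ring.
Qed.

(** Orthogonality recovers the coefficients from the values at the points. *)
Lemma schur_map_inj : injective smap.
Proof.
move=> a b ab; apply/ffunP => v; apply/eqP; rewrite -subr_eq0.
have zero : smap (a - b) = pi 0 by rewrite schur_mapB ab subrr raddf0.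
have h := sum_Smatrix (a - b) v.
have -> : a v - b v = (a - b) v by rewrite !ffunE.
rewrite -(eqr_int R[i]) -h big1 // => s _.
under eq_bigr => l _ do rewrite Smatrix_numer // mulrCA.
by rewrite -mulr_sumr -(schur_map_numer zero) raddf0 mul0r mulr0 mul0r.
Qed.

Lemma schur_map_bij : bijective smap.
Proof.
have surj q : exists a, smap a == q by have [a <-] := schur_map_surj n_gt0 q; exists a.
exists (fun q => xchoose (surj q)) => [a|q]; last exact/eqP/(xchooseP (surj q)).
by apply: schur_map_inj; apply/eqP/(xchooseP (surj _)).
Qed.

Lemma schur_map_one : smap (fusion_one n k) = 1.
Proof.
have [v vE] := vacuum_weight.
rewrite /schur_map (bigD1 v) //= big1 ?addr0 => [|l ne].
  rewrite ffunE; have -> : [forall i, labels v i == vacuum k i] by apply/forallP => i; rewrite vE.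
  by rewrite schur0 ?rmorph1 // => i; apply: transpose_vacuum.
rewrite ffunE (_ : [forall i, labels l i == vacuum k i] = false) ?mulr0z //.
apply: contraNF ne => /forallP lE; apply/eqP/beta_weight_inj => i; rewrite /beta.
by congr (_ + _)%N; apply: part_eq => j; rewrite vE; apply/eqP.
Qed.

Lemma schur_map_fusion_iso : fusion_iso R smap.
Proof.
split; [|exact: schur_mapM | exact: schur_map_one | exact: schur_map_bij].
move=> a b; rewrite /schur_map -big_split; apply: eq_bigr => l _.
by rewrite ffunE mulrzDr.
Qed.

End Verlinde.

(** * The quotient of quantum cohomology *)

Section QuotLift.
Variables (R S : comPzRingType) (gens : seq R) (phi : {rmorphism R -> S}).

Definition quot_lift of (forall y, y \in gens -> phi y = 0) :=
  fun q : quotring gens => phi (generic_quotient.repr q).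

Hypothesis phi0 : forall y, y \in gens -> phi y = 0.
Local Notation lift := (quot_lift phi0).

Lemma quot_liftE x : lift (quotring_proj gens x) = phi x.
Proof.
apply/eqP; rewrite -subr_eq0 -rmorphB; apply/eqP; apply: (rmorph_ideal_gen phi0).
apply/quotring_projP; rewrite /quotring_proj; exact: generic_quotient.reprK.
Qed.

Lemma quot_lift_zmod : zmod_morphism lift.
Proof.
move=> a b; have [x <-] := quotring_proj_surj a; have [y <-] := quotring_proj_surj b.
by rewrite -rmorphB !quot_liftE rmorphB.
Qed.

Lemma quot_lift_monoid : monoid_morphism lift.
Proof.
split=> [|a b]; first by rewrite -(rmorph1 (quotring_proj gens)) quot_liftE rmorph1.
have [x <-] := quotring_proj_surj a; have [y <-] := quotring_proj_surj b.
by rewrite -rmorphM !quot_liftE rmorphM.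
Qed.

HB.instance Definition _ := GRing.isZmodMorphism.Build (quotring gens) S
  lift quot_lift_zmod.
HB.instance Definition _ := GRing.isMonoidMorphism.Build (quotring gens) S
  lift quot_lift_monoid.

End QuotLift.

Section QuantumQuotient.
Variables (n k' : nat).
Local Notation k := k'.+1.
Local Notation A := (sympoly k).
Local Notation Q := (quotring (fusion_rels n k)).
Local Notation Q' := (quotring (qH_fusion_rels n k)).
Local Notation pi := (quotring_proj (fusion_rels n k)).
Local Notation projH := (quotring_proj (qH_rels n k)).
Local Notation proj' := (quotring_proj (qH_fusion_rels n k)).

Definition const_to_quantum : A -> Q' := proj' \o (projH \o polyC).
HB.instance Definition _ := GRing.RMorphism.on const_to_quantum.

Definition eval_q : {poly A} -> Q := pi \o horner_eval (sym_e k k).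
HB.instance Definition _ := GRing.RMorphism.on eval_q.

Lemma const_to_quantumE x : const_to_quantum x = proj' (projH x%:P).
Proof. by []. Qed.

Lemma eval_qE p : eval_q p = pi p.[sym_e k k].
Proof. by []. Qed.

Lemma quantum_q_eq_e : proj' (projH ('X - (sym_e k k)%:P)) = 0.
Proof. by apply: quotring_proj_gen; apply: mem_head. Qed.

(** The last relation is the relation for [h_(n + k)] in quantum cohomology, minus
    a multiple of [q - e_k]. *)
Lemma const_to_quantum_rels x : x \in fusion_rels n k -> const_to_quantum x = 0.
Proof.
rewrite !inE mem_cat !inE => /or3P[/eqP ->|/mapP[i i_bnd ->]|/eqP ->].
- rewrite const_to_quantumE polyCB polyC1.
  apply: quotring_proj_gen; rewrite in_cons mem_seq1; apply/orP; right.
  exact: eqxx.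
- rewrite const_to_quantumE (_ : projH _ = 0) ?rmorph0 //.
  by apply: quotring_proj_gen; rewrite mem_cat; apply/orP; left; apply: map_f.
have XX : (sym_h k (n + k) + (-1) ^+ k * sym_e k k)%:P
    = (sym_h k (n + k))%:P + (-1) ^+ k * 'X - (-1) ^+ k * ('X - (sym_e k k)%:P) :> {poly A}.
  by rewrite polyCD polyCM rmorphXn rmorphN1 mulrBr opprB addrCA addrC addrK addrC.
have h_q : projH ((sym_h k (n + k))%:P + (-1) ^+ k * 'X) = 0.
  by apply: quotring_proj_gen; rewrite mem_cat mem_seq1 eqxx orbT.
have E : projH ((sym_h k (n + k) + (-1) ^+ k * sym_e k k)%:P)
    = - (projH ((-1) ^+ k) * projH ('X - (sym_e k k)%:P)).
  by rewrite XX rmorphB /= h_q sub0r rmorphM.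
by rewrite const_to_quantumE E rmorphN rmorphM /= quantum_q_eq_e mulr0 oppr0.
Qed.

Lemma eval_q_rels x : x \in qH_rels n k -> eval_q x = 0.
Proof.
rewrite mem_cat mem_seq1 => /orP[x_in|/eqP ->].
  have [j] := mapP x_in; rewrite mem_iota => j_bnd ->; rewrite eval_qE hornerC.
  exact: fusion_h_gt_n.
rewrite eval_qE hornerD hornerC hornerM hornerX horner_exp hornerN hornerC.
by apply: quotring_proj_gen; rewrite inE mem_cat mem_seq1 eqxx !orbT.
Qed.

Definition eval_qH : qH n k -> Q := quot_lift eval_q_rels.
HB.instance Definition _ := GRing.RMorphism.on eval_qH.

Lemma eval_qHE p : eval_qH (projH p) = pi p.[sym_e k k].
Proof. exact: quot_liftE. Qed.

Lemma eval_qH_rels x : x \in qH_fusion_rels n k -> eval_qH x = 0.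
Proof.
rewrite !inE => /orP[]/eqP ->; rewrite eval_qHE.
  by rewrite hornerXsubC subrr rmorph0.
by rewrite !hornerE rmorphB /= fusion_h_n rmorph1 subrr.
Qed.

Definition to_quantum : Q -> Q' := quot_lift const_to_quantum_rels.
HB.instance Definition _ := GRing.RMorphism.on to_quantum.
Definition of_quantum : Q' -> Q := quot_lift eval_qH_rels.

Lemma to_quantumE x : to_quantum (pi x) = proj' (projH x%:P).
Proof. exact: quot_liftE. Qed.

Lemma of_quantumE p : of_quantum (proj' (projH p)) = pi p.[sym_e k k].
Proof. by rewrite -eval_qHE; apply: quot_liftE. Qed.

Lemma to_quantumK : cancel to_quantum of_quantum.
Proof.
move=> q; have [x <-] := quotring_proj_surj q.
by rewrite to_quantumE of_quantumE hornerC.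
Qed.

(** Modulo [q - e_k], a polynomial in [q] is equal to its value at [q = e_k]. *)
Lemma of_quantumK : cancel of_quantum to_quantum.
Proof.
move=> q; have [z <-] := quotring_proj_surj q; have [p <-] := quotring_proj_surj z.
rewrite of_quantumE to_quantumE; apply/eqP; rewrite eq_sym -subr_eq0 -!rmorphB.
have /factor_theorem[r ->] : root (p - p.[sym_e k k]%:P) (sym_e k k).
  by rewrite /root !hornerE subrr.
by rewrite /= rmorphM /= rmorphM /= quantum_q_eq_e mulr0.
Qed.

End QuantumQuotient.

Theorem theorem1p3 (R : realType) (n k : nat) (hn : (2 <= n)%N) (hk : (1 <= k)%N) :
  [/\ forall l m v : weight n k,
        (fusion_coef R l m v)%:~R = verlinde R l m v,
      fusion_iso R (@schur_map n k)
    & exists f : fusion n k -> quotring (qH_fusion_rels n k), fusion_iso R f].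
Proof.
have n_gt0 : (0 < n)%N by apply: ltnW.
case: k hk => // k' _; have iso := @schur_map_fusion_iso R n k' n_gt0.
split=> //; first by move=> l m v; apply: fusion_coef_verlinde.
exists (@to_quantum n k' \o @schur_map n k'.+1); case: iso => fD fM f1 fbij; split.
- by move=> a b; rewrite /= fD rmorphD.
- by move=> a b; rewrite /= fM rmorphM.
- by rewrite /= f1 rmorph1.
by apply: bij_comp => //; exists (@of_quantum n k'); [apply: to_quantumK | apply: of_quantumK].
Qed.
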